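(* Every non-bipartite cubic graph $G$ which has a $1$-factor has a signature $\sigma$ such that $|N_\sigma| = \omega(G)$ and $F_c((G,\sigma)) = F((G,\sigma)) = 4$. Furthermore, if $G$ is bridgeless, then for every $3$-minimal set $X_3 \subseteq E(G)$ there is a $4$-minimal set $X_4 \subseteq E(G)$ such that $X_4$ is a proper subset of $X_3$ and $|X_4| \le \omega(G) < |X_3|$.
   Context: Graphs are finite and may have parallel edges but no loops. A $k$-factor is a spanning $k$-regular subgraph. For a cubic graph $G$ with a $2$-factor, the oddness $\omega(G)$ is the minimum number of odd circuits of a $2$-factor of $G$. A signed graph $(G,\sigma)$ is a graph $G$ with a function (signature) $\sigma: E(G)\to\{\pm1\}$; $N_\sigma=\{e:\sigma(e)=-1\}$. Each edge $e=uv$ is divided into two half-edges $h_e^u$ (incident with $u$) and $h_e^v$ (incident with $v$); $H(G)$ is the set of half-edges, $H(v)$ the set of half-edges incident with $v$, and $e_h$ the edge containing the half-edge $h$. An orientation of $(G,\sigma)$ is a function $\tau: H(G)\to\{\pm1\}$ with $\tau(h_e^u)\tau(h_e^v) = -\sigma(e)$ for each edge $e=uv$. Given an orientation $\tau$, the boundary of $f:E(G)\to\mathbb{R}$ is $\delta f(v)=\sum_{h\in H(v)}\tau(h)f(e_h)$. For real $r\ge 2$, $f$ is an $r$-flow on $(G,\sigma)$ if, for every edge $e$, $f(e)=0$ or $1\le |f(e)|\le r-1$, and $\delta f(v)=0$ for all $v\in V(G)$; it is nowhere-zero if $f(e)\ne 0$ for all $e$. $(G,\sigma)$ admits a nowhere-zero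 $r$-flow if one exists for some orientation. $F_c((G,\sigma))=\inf\{r : (G,\sigma)\text{ admits a nowhere-zero }r\text{-flow}\}$, and $F((G,\sigma))$ is the smallest integer $k$ such that $(G,\sigma)$ admits an integer-valued nowhere-zero $k$-flow (both are $\infty$ if no such flow exists). For real $r\ge 2$, a set $X\subseteq E(G)$ is $r$-minimal if 1) the signature $\sigma$ of $G$ with $N_\sigma=X$ satisfies $F_c((G,\sigma))=r$, and 2) $F_c((G,\sigma'))\neq r$ for every signature $\sigma'$ of $G$ with $N_{\sigma'}$ a proper subset of $X$. *)

(* Defs.v *)
From mathcomp Require Import all_boot all_order all_algebra.
From mathcomp Require Import boolp classical_sets reals constructive_ereal ereal.

Set Implicit Arguments.
Unset Strict Implicit.
Unset Printing Implicit Defensive.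

Import Order.TTheory GRing.Theory Num.Theory.
Local Open Scope ring_scope.

(** Finite graphs: parallel edges allowed, no loops, not necessarily
    connected. *)
Record multigraph := Multigraph {
  vertex : finType;
  edge : finType;
  ends : edge -> {set vertex};
  card_ends : forall e, #|ends e| = 2%N }.

Section Graphs.
Variable G : multigraph.
Implicit Types (e : edge G) (u v : vertex G) (F C : {set edge G}).

(** A set [F] of edges stands for the spanning subgraph with edge set [F]. *)
Definition degree F v : nat := #|[set e in F | v \in ends e]%SET|.

Definition adjacent F : rel (vertex G) :=
  fun u v => (u != v) && [exists e in F, ends e == [set u; v]%SET].

Definition cubic : Prop := forall v, degree [set: edge G]%SET v = 3%N.

Definition bipartite : Prop :=
  exists A : {set vertex G}, forall e, #|(ends e :&: A)%SET| = 1%N.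

Definition factor (k : nat) F : bool := [forall v, degree F v == k].

(** A bridge is an edge separating its ends. *)
Definition bridge e : bool :=
  [exists u in ends e, [exists v in ends e,
    ~~ connect (adjacent [set~ e]%SET) u v]].

Definition bridgeless : Prop := forall e, ~~ bridge e.

(** A circuit is a nonempty connected 2-regular subgraph, given by its set
    of edges; vertices of degree 0 in [C] do not belong to the circuit. *)
Definition circuit C : bool :=
  [&& C != finset.set0,
      [forall v, (degree C v == 0%N) || (degree C v == 2%N)] &
      [forall u, forall v, (0 < degree C u)%N && (0 < degree C v)%N ==>
         connect (adjacent C) u v]].

Definition odd_circuits F : {set {set edge G}} :=
  [set C : {set edge G} | [&& C \subset F, circuit C & odd #|C|]]%SET.

(** [#|edge G|] bounds the number of odd circuits of any 2-factor, so that
    this is the minimum as soon as [G] has a 2-factor. *)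
Definition oddness : nat :=
  \big[Order.min/#|edge G|]_(F : {set edge G} | factor 2 F) #|odd_circuits F|.

(** In signatures and orientations, [b : bool] encodes the sign
    [(-1) ^+ b]: [true] is -1. *)
Definition signature := {ffun edge G -> bool}.

Definition negative_edges (sigma : signature) : {set edge G} :=
  [set e | sigma e]%SET.

Definition signature_of (X : {set edge G}) : signature :=
  [ffun e => e \in X].

(** As there are no loops, the half-edge of [e] at its end [v] is
    the pair [(e, v)]. *)
Definition half_edge : finType :=
  {h : edge G * vertex G | h.2 \in ends h.1}.

Definition half_edge_edge (h : half_edge) : edge G := (val h).1.
Definition half_edge_vertex (h : half_edge) : vertex G := (val h).2.

Definition orientation (sigma : signature) (tau : half_edge -> bool) : Prop :=
  forall h h' : half_edge, h != h' -> half_edge_edge h = half_edge_edge h' ->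
    (-1) ^+ tau h * (-1) ^+ tau h' = - (-1) ^+ sigma (half_edge_edge h) :> int.

Section Flows.
Variable R : realType.
Implicit Types (tau : half_edge -> bool) (f : edge G -> R) (r : R).

Definition boundary tau f v : R :=
  \sum_(h : half_edge | half_edge_vertex h == v)
    (-1) ^+ tau h * f (half_edge_edge h).

Definition flow tau r f : Prop :=
  (forall e, f e = 0 \/ 1 <= `|f e| <= r - 1) /\
  (forall v, boundary tau f v = 0).

Definition nowhere_zero f : Prop := forall e, f e != 0.

Definition admits_nz_flow (sigma : signature) r : Prop :=
  2 <= r /\ exists tau f,
    [/\ orientation sigma tau, flow tau r f & nowhere_zero f].

Definition admits_nz_int_flow (sigma : signature) (k : nat) : Prop :=
  2 <= k%:R :> R /\ exists tau f,
    [/\ orientation sigma tau, flow tau k%:R f, nowhere_zero f &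
        forall e, f e \is a Num.int].

Definition circular_flow_number (sigma : signature) : \bar R :=
  ereal_inf [set r%:E | r in [set r | admits_nz_flow sigma r]]%classic.

Definition flow_number (sigma : signature) : \bar R :=
  match pselect (exists k, `[< admits_nz_int_flow sigma k >]) with
  | left exk => (ex_minn exk)%:R%:E
  | right _ => +oo%E
  end.

Definition minimal_set r (X : {set edge G}) : Prop :=
  circular_flow_number (signature_of X) = r%:E /\
  forall sigma' : signature, negative_edges sigma' \proper X ->
    circular_flow_number sigma' <> r%:E.

End Flows.
End Graphs.

Arguments circular_flow_number {G} R sigma.
Arguments flow_number {G} R sigma.
Arguments minimal_set {G R} r X.

(* Main.v *)
Require Import Defs.
From mathcomp Require Import all_boot all_order all_algebra.
From mathcomp Require Import boolp classical_sets reals constructive_ereal ereal.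
From mathcomp Require Import lra zify.
From mathcomp Require Import fintype finset.

(** In a cubic graph a nowhere-zero flow below 4 is very rigid.  The three values at a vertex
    sum to zero and lie in absolute value in [1, 3), so exactly one of them
    reaches 2 and it has the sign opposite to the other two.  Let [A] be the set of
    vertices where that sign is positive: an edge is positive exactly when it
    crosses [A].  Hence a flow number below 4 forces the negative edges to be
    the complement of a cut ([pair_flow_lt4]; call such a set antibalanced), no
    flow number is below 3 once there is an edge ([pair_flow_ge3]), and
    conversely, as soon as there is a 1-factor, values 2 on it and 1 elsewhere
    give a 3-flow ([antibalanced_flow3]).  So the flow number is 3 exactly for antibalanced
    sets, and 4 for every other set that carries a 4-flow.

    Let [F] be a 2-factor with complementary 1-factor [M], and let [X] contain
    exactly one edge of each odd circuit of [F] and nothing else (an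
    [odd_transversal]).  Then [X] carries an integer 4-flow
    ([transversal_flow4]).  Mark one end of every edge of [X].  Each circuit of
    [F], minus its marked vertex if it has one, has a perfect matching; let [M2] be the union
    of these, chosen to avoid [X].  The graph [M :|: M2] consists of positive edges, its
    components are circuits and paths between marked vertices, so it carries a
    flow [g] with values 1 and -1 and excess 1 or -1 at the marked vertices.
    An odd circuit of [F] has one negative edge, so a unit flow around it
    has excess 2 or -2, at the marked vertex; circuit by circuit the sign can be chosen
    to cancel that of [2 g].  The sum is the desired flow.  Every choice in this
    construction is a linear system over the field with two elements, and is
    solved by the Fredholm alternative ([parity_system]) rather than by
    walking along circuits.

    For the first claim, take [F] with [oddness G] odd circuits.  A transversal
    has the right size, and it remains to find one that is not antibalanced.
    If all were, exchanging the chosen edge of one odd circuit would show that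
    every edge of [M] at an odd circuit is by itself a cut; a minimal vertex
    set bounded by a single edge then contains an odd circuit of [F], which
    produces a smaller such set ([no_odd_circuit]).  So [F] has no odd circuit,
    the empty set is antibalanced, and [G] is bipartite.

    For the second claim, a 3-minimal set [X3] is antibalanced, hence meets
    every odd circuit, and contains a transversal [X] of [F].  By
    Schonberger's theorem ([edge_in_factor], deduced from Tutte's theorem
    [tutte]) some 1-factor [M'] contains an edge of [X3]; the odd circuits of its
    complement all meet [X3 :\: M'], so [oddness G < #|X3|].  Hence [X] is a
    proper subset of [X3], it is not antibalanced by minimality of [X3], and
    any inclusion-minimal subset of it with flow number 4 is the required
    [X4]. *)

Import Order.TTheory GRing.Theory Num.Theory.
Local Open Scope ring_scope.
Set Implicit Arguments.
Unset Strict Implicit.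
Unset Printing Implicit Defensive.

(** * Tutte's theorem on perfect matchings *)

Section Tutte.
Local Open Scope nat_scope.
Variable T : finType.
Implicit Types (e : rel T) (m : T -> T) (x y z : T) (U : {set T}).

Definition perfect_matching e m := forall x, m (m x) = x /\ e x (m x).

(** A barrier [U] comes with a labelling [c] of the remaining vertices that is
    constant along edges, in place of the connected components: label classes
    are unions of components, and this form is visibly inherited by subgraphs. *)
Definition label_class U (c : T -> T) l := [set x | (x \notin U) && (c x == l)].

Definition odd_labels U (c : T -> T) := [set l | odd #|label_class U c l|].

Definition barrier e U (c : T -> T) :=
  (forall x y, x \notin U -> y \notin U -> e x y -> c x = c y) /\
  #|U| < #|odd_labels U c|.

Definition add_edge e x z : rel T :=
  fun u v => [|| e u v, (u == x) && (v == z) | (u == z) && (v == x)].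

Definition near_perfect_matching e x y m :=
  [/\ involutive m, m x = x, m y = y &
      forall z, z != x -> z != y -> e z (m z)].

Lemma even_fixfree_involution (A : {set T}) m :
  involutive m -> {in A, forall x, m x \in A /\ m x != x} -> ~~ odd #|A|.
Proof.
move=> mK; elim: {A}_.+1 {-2}A (ltnSn #|A|) => // n IHn A leAn mA.
have [->|[x xA]] := set_0Vmem A; first by rewrite cards0.
have [mxA mxx] := mA x xA.
have cardA : #|A| = #|A :\ x :\ m x|.+2.
  by rewrite (cardsD1 x) xA (cardsD1 (m x) (A :\ x)) !inE mxx mxA.
rewrite cardA /= negbK IHn //; first by move: leAn; rewrite cardA; lia.
move=> z; rewrite !inE => /and3P[zmx zx zA].
have [mzA mzz] := mA z zA; split=> //.
rewrite mzA andbT; apply/andP; split.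
  by apply: contraNneq zx => /(can_inj mK) ->.
by apply: contraNneq zmx => <-; rewrite mK.
Qed.

(** The augmentation step of Lovasz's proof.  In the union of [m1] and [m2],
    follow the alternating circuit from [y] through [w].  If it returns to [y]
    without meeting [x] or [z], use [m1] on it and [m2] elsewhere: neither new edge is
    used.  Otherwise stop at the first [t] among [x] and [z], close up with the
    edge [y t], and use [m1] strictly between. *)
Lemma switch_matchings e x y z w m1 m2 :
  symmetric e -> e y x -> e y z -> ~~ e y w -> x != z -> y != w ->
  perfect_matching (add_edge e x z) m1 -> m1 x = z ->
  perfect_matching (add_edge e y w) m2 -> m2 y = w ->
  irreflexive e ->
  exists m, perfect_matching e m.
Proof.
move=> esym eyx eyz neyw xz yw pm1 m1x pm2 m2y eirr.
have m1K u : m1 (m1 u) = u by case: (pm1 u).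
have m2K u : m2 (m2 u) = u by case: (pm2 u).
have m1z : m1 z = x by rewrite -m1x m1K.
have m2w : m2 w = y by rewrite -m2y m2K.
have wx : w != x by apply: contraNneq neyw => ->.
have wz : w != z by apply: contraNneq neyw => ->.
have m1e u : u != x -> u != z -> e u (m1 u).
  by move=> /negPf ux /negPf uz; case: (pm1 u) => _; rewrite /add_edge ux uz !orbF.
have m2e u : u != y -> u != w -> e u (m2 u).
  by move=> /negPf ux /negPf uz; case: (pm2 u) => _; rewrite /add_edge ux uz !orbF.
have m1n u : m1 u != u.
  apply/negP => /eqP m1u; case: (pm1 u); rewrite m1u /add_edge eirr /= => _.
  by case/orP=> /andP[/eqP -> /eqP E]; move: xz; rewrite E eqxx.
have m2n u : m2 u != u.
  apply/negP => /eqP m2u; case: (pm2 u); rewrite m2u /add_edge eirr /= => _.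
  by case/orP=> /andP[/eqP -> /eqP E]; move: yw; rewrite E eqxx.
pose p u := m2 (m1 u); pose q i := iter i p w.
have qS i : q i.+1 = m2 (m1 (q i)) by [].
have [hit|nohit] := pselect (exists i, (q i == x) || (q i == z)).
  have [k [kP kmin]] : exists k, ((q k == x) || (q k == z)) /\
      (forall i, i < k -> (q i != x) && (q i != z)).
    case: (ex_minnP hit) => k kP kmin; exists k; split=> // i.
    by rewrite -negb_or ltnNge; apply: contra; apply: kmin.
  pose t := q k.
  have eyt : e y t by rewrite /t; case/orP: kP => /eqP ->.
  pose K := [set v | [exists i : 'I_k, (v == q i) || (v == m1 (q i))]].
  have KP v : reflect (exists2 i, i < k & v = q i \/ v = m1 (q i)) (v \in K).
    rewrite inE; apply: (iffP existsP) => [[i /orP H]|[i lik H]].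
      by exists i => //; case: H => /eqP; [left | right].
    by exists (Ordinal lik) => /=; apply/orP; case: H => ->; [left | right].
  have k_gt0 : 0 < k.
    by rewrite lt0n; apply/negP => /eqP k0; move: kP; rewrite k0 /= (negPf wx) (negPf wz).
  have wK : w \in K by apply/KP; exists 0 => //; left.
  have Km1 v : (m1 v \in K) = (v \in K).
    apply/KP/KP => -[i lik []] E; exists i => //; [right | left | right | left];
    by [rewrite -E m1K | rewrite -[v]m1K E m1K | rewrite E | rewrite E m1K].
  have hitm1 u : (u == x) || (u == z) -> (m1 u == x) || (m1 u == z).
    by case/orP=> /eqP ->; rewrite ?m1x ?m1z eqxx ?orbT.
  have hitK v : (v == x) || (v == z) -> v \notin K.
    move=> vxz; apply/KP => -[i /kmin]; rewrite -negb_or => /negP H [] E; apply: H.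
      by rewrite -E.
    by rewrite -[q i]m1K -E hitm1.
  have tK : t \notin K by apply: hitK.
  (* Points at even and odd distance from [w] on the alternating walk differ:
     otherwise the walk folds back onto itself, and its middle is a fixed point. *)
  have alt d i : q (i + d) <> m1 (q i).
    elim: {d}_.+1 {-2}d (ltnSn d) i => // n IHn [|[|d]] ltdn i.
    - by rewrite addn0; move/eqP; rewrite eq_sym (negPf (m1n _)).
    - by rewrite addn1 qS; move/eqP; rewrite (negPf (m2n _)).
    rewrite !addnS qS => E; apply: (IHn d _ i.+1); first exact: ltnW.
    by rewrite addSn [in RHS]qS -E m2K m1K.
  have yK : y \notin K.
    apply/KP => -[i lik []].
      case: i lik => [|i] lik E; first by move: yw; rewrite E eqxx.
      apply: (@alt i 0); rewrite add0n -[q 0]/w -m2y E.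
      by rewrite qS m2K m1K.
    (* The walk would have closed up at [y] before reaching [t]. *)
    move=> E; have Ei : q i.+1 = w by rewrite qS -E.
    have Ek : q k = q (k - i.+1).
      by rewrite -{1}(subnK lik) /q iterD; have -> : iter i.+1 p w = w := Ei.
    have /kmin : k - i.+1 < k by rewrite ltn_subrL k_gt0.
    by rewrite -Ek -negb_or kP.
  have ty : t != y by apply: contraTneq eyt => ->; rewrite eirr.
  have yt : y != t by rewrite eq_sym.
  have yE : (y \in K) = false by apply: negbTE.
  have tE : (t \in K) = false by apply: negbTE.
  pose m v := if v == y then t else if v == t then y else
              if v \in K then m1 v else m2 v.
  exists m => v; rewrite /m.
  have [->|vy] := eqVneq v y; first by rewrite eqxx (negPf ty).
  have [->|vt] := eqVneq v t; first by rewrite eqxx esym.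
  have [vK|vK] := boolP (v \in K).
    have m1vy : m1 v != y by apply: contraNneq yK => <-; rewrite Km1.
    have m1vt : m1 v != t by apply: contraNneq tK => <-; rewrite Km1.
    rewrite (negPf m1vy) (negPf m1vt) Km1 vK m1K; split=> //.
    by apply: m1e; apply: contraL vK => /eqP ->; apply: hitK; rewrite eqxx ?orbT.
  have m2vy : m2 v != y.
    by apply: contraNneq vK => E; rewrite -(m2K v) E m2y.
  have m2vt : m2 v != t.
    apply: contraNneq vK => E; apply/KP; exists k.-1; first by rewrite prednK.
    right; rewrite -(m2K v) E /t -{1}(prednK k_gt0) qS m2K //.
  have m2vK : m2 v \notin K.
    apply: contra vK => /KP[i lik []] E; apply/KP; last first.
      have [li1k|] := ltnP i.+1 k.
        by exists i.+1 => //; left; rewrite -(m2K v) E.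
      move=> lki; case/eqP: vt; rewrite -(m2K v) E -qS /t; congr q; by apply/eqP; rewrite eqn_leq lik lki.
    case: i lik E => [|i] lik E; first by case/eqP: vy; rewrite -(m2K v) E.
    by exists i; [exact: ltnW | right; rewrite -(m2K v) E qS m2K].
  rewrite (negPf m2vy) (negPf m2vt) (negPf m2vK) m2K; split=> //.
  by apply: m2e => //; apply: contraNneq vK => ->.
have pinj : injective p by move=> u v; rewrite /p => /(can_inj m2K) /(can_inj m1K).
pose K := [set v | fconnect p w v || fconnect p w (m1 v)].
have Km1 v : (m1 v \in K) = (v \in K) by rewrite !inE m1K orbC.
have Km2 v : v \in K -> m2 v \in K.
  rewrite !inE => /orP[cv|cv]; apply/orP; [right|left].
    have -> : m1 (m2 v) = finv p v.
      by apply: (pinj); rewrite (f_finv pinj) /p m1K m2K.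
    exact: connect_trans cv (fconnect_finv _ _).
  by apply: connect_trans cv _; rewrite -{2}[v]m1K; apply: fconnect1.
have wK : w \in K by rewrite inE connect0.
have yK : y \in K by rewrite -m2w Km2.
have xK : x \notin K.
  rewrite inE m1x; apply/negP=> /orP[] /iter_findex E; apply: nohit;
  [exists (findex p w x) | exists (findex p w z)]; by rewrite /q E eqxx ?orbT.
have zK : z \notin K by rewrite -m1x Km1.
exists (fun v => if v \in K then m1 v else m2 v) => v.
have [vK|vK] := boolP (v \in K).
  by rewrite Km1 vK m1K; split=> //; apply: m1e; apply: contraTneq vK => ->.
have m2vK : m2 v \notin K by apply: contra vK => /Km2; rewrite m2K.
rewrite (negPf m2vK) m2K; split=> //.
by apply: m2e; apply: contraNneq vK => ->.
Qed.

Lemma augment e x y m :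
  symmetric e -> near_perfect_matching e x y m -> x != y -> e x y ->
  exists m', perfect_matching e m'.
Proof.
move=> esym [mK mx my me] xy exy.
exists (fun v => if v == x then y else if v == y then x else m v) => v.
have [->|vx] := eqVneq v x; first by rewrite eq_sym (negPf xy) !eqxx.
have [->|vy] := eqVneq v y; first by rewrite !eqxx esym.
rewrite mK -{1}mx -{2}my !(inj_eq (can_inj mK)) (negPf vx) (negPf vy).
by split=> //; apply: me.
Qed.

(** Rematching [s] with the uncovered [x] uncovers its former partner instead.
    The frame condition lets two rotations be made in succession. *)
Lemma rotate e x y s m :
  symmetric e -> irreflexive e ->
  near_perfect_matching e x y m -> x != y -> e s x ->
  s != x -> s != y -> exists m', near_perfect_matching e (m s) y m' /\
    forall u, u != s -> u != x -> u != m s -> m' u = m u.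
Proof.
move=> esym eirr [mK mx my me] xy esx sx sy.
have msx : m s != x by rewrite -{1}mx (inj_eq (can_inj mK)).
have msy : m s != y by rewrite -{1}my (inj_eq (can_inj mK)).
have mss : m s != s by apply: contraTneq (me s sx sy) => ->; rewrite eirr.
have sms : s != m s by rewrite eq_sym.
pose m' v := if v == s then x else if v == x then s else
             if v == m s then m s else m v.
exists m'; split; last by move=> u /negPf us /negPf ux /negPf ums; rewrite /m' us ux ums.
split; rewrite /m'.
- move=> v; have [->|vs] := eqVneq v s; first by rewrite eq_sym (negPf sx) eqxx.
  have [->|vx] := eqVneq v x; first by rewrite eqxx.
  have [->|vms] := eqVneq v (m s); first by rewrite (negPf mss) (negPf msx) eqxx.
  have -> : (m v == s) = false.
    by apply: contraNF vms => /eqP <-; rewrite mK.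
  have -> : (m v == x) = false by rewrite -{1}mx (inj_eq (can_inj mK)) (negPf vx).
  by rewrite (inj_eq (can_inj mK)) (negPf vs) mK.
- by rewrite (negPf mss) (negPf msx) eqxx.
- rewrite my [y == s]eq_sym (negPf sy) [y == x]eq_sym (negPf xy).
  by rewrite [y == m s]eq_sym (negPf msy).
move=> z zms zy.
have [->//|zs] := eqVneq z s; have [->|zx] := eqVneq z x; first by rewrite esym.
by rewrite (negPf zms) me.
Qed.

Lemma complete_matching e : (forall x y, x != y -> e x y) -> ~~ odd #|T| ->
  exists m, perfect_matching e m.
Proof.
move=> ecomp evenT.
exists (fun x => enum_val (rev_ord (enum_rank x))) => x.
rewrite enum_valK rev_ordK enum_rankK; split=> //; apply: ecomp.
apply: contraNneq evenT => /(congr1 enum_rank).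
rewrite enum_valK => /(congr1 val) /=; have := ltn_ord (enum_rank x).
by move: #|T| (nat_of_ord _) => n i; lia.
Qed.

(** When adjacency is transitive outside the set [U] of vertices joined to all
    others, [U] is a barrier for the cliques outside it.  Take a matching
    missing only [x] and [y].  Rotations show that [x], [y] and the partners of
    [U] are pairwise non-adjacent, as otherwise the matching could be
    augmented; so they lie in [#|U| + 2] different cliques, and each of these
    cliques is odd because the rest of it is matched internally. *)
Lemma clique_barrier e : symmetric e -> irreflexive e ->
  (forall x y z, x != z -> e x y -> e y z -> ~~ e x z -> forall w, w != y -> e y w) ->
  (forall x y, x != y -> ~~ e x y -> exists m, near_perfect_matching e x y m) ->
  (exists m, perfect_matching e m) \/ exists U c, barrier e U c.
Proof.
move=> esym eirr etrans near.
have [pm|npm] := pselect (exists m, perfect_matching e m); [by left | right].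
have [[x [y [xy nexy]]]|compl] := pselect (exists x y, x != y /\ ~~ e x y); last first.
  have ecomp x y : x != y -> e x y.
    by move=> xy; apply/negPn/negP => nexy; apply: compl; exists x, y.
  have oddT : odd #|T| by apply/negPn/negP => /(complete_matching ecomp).
  have x0 : T by have: 0 < #|T| by [case: #|T| oddT]; move=> /card_gt0P/sigW[].
  exists set0, (fun=> x0); split=> //; rewrite cards0; apply/card_gt0P.
  exists x0; rewrite inE; suff -> : label_class set0 (fun=> x0) x0 = setT by rewrite cardsT.
  by apply/setP => u; rewrite !inE eqxx.
pose U := [set s | [forall u, (u != s) ==> e s u]].
have Ue s u : s \in U -> u != s -> e s u by rewrite inE => /forallP/(_ u)/implyP.
have nUe s u : s != u -> ~~ e s u -> s \notin U.
  by rewrite eq_sym => su; apply: contra => /Ue ->.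
have etr a b d : b \notin U -> a != d -> e a b -> e b d -> e a d.
  move=> bU ad eab ebd; apply/negPn/negP => nead; case/negP: bU.
  rewrite inE; apply/forallP=> w; apply/implyP => wb.
  exact: (etrans a b d).
clearbody U.
pose c u := odflt u [pick v | (v \notin U) && ((v == u) || e u v)].
have cE u v : u \notin U -> v \notin U -> e u v -> c u = c v.
  move=> uU vU euv; rewrite /c.
  have -> : [pick w | (w \notin U) && ((w == u) || e u w)] =
            [pick w | (w \notin U) && ((w == v) || e v w)].
    apply: eq_pick => w /=; have [//|wU] := boolP (w \in U); rewrite /=.
    have evu : e v u by rewrite esym.
    have [->|wu] := eqVneq w u; first by rewrite evu orbT.
    have [->|wv] := eqVneq w v; first by rewrite euv.
    by apply/idP/idP => /=; apply: etr => //; rewrite eq_sym.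
  by case: pickP => //= /(_ v); rewrite vU eqxx.
have cP u : u \notin U -> c u \notin U /\ (c u == u) || e u (c u).
  by move=> uU; rewrite /c; case: pickP => [w /andP[]//|/(_ u)]; rewrite uU eqxx.
have cadj u v : u \notin U -> v \notin U -> c u = c v -> u != v -> e u v.
  move=> uU vU cuv uv; have [cuU] := cP u uU; have [_] := cP v vU.
  rewrite -cuv => /orP[/eqP cv|evc].
    by case/orP=> [/eqP cu|]; [move: uv; rewrite -cv cu eqxx | rewrite cv].
  case/orP=> [/eqP E|euc]; first by rewrite -E esym.
  by apply: (etr u (c u)) => //; rewrite esym.
have [m npm_m] := near x y xy nexy; have [mK mx my me] := npm_m.
have noadj u v m' : u != v -> near_perfect_matching e u v m' -> ~~ e u v.
  by move=> uv npm'; apply/negP=> /(augment esym npm' uv).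
have xU : x \notin U by apply: nUe nexy.
have yU : y \notin U by apply: (nUe y x); rewrite 1?eq_sym // esym.
pose Z := x |: (y |: (m @: U)).
have minj := can_inj mK.
have Ux s : s \in U -> s != x by apply: contraTneq => ->.
have Uy s : s \in U -> s != y by apply: contraTneq => ->.
have mUx s : s \in U -> m s != x by move=> sU; rewrite -{1}mx (inj_eq minj) Ux.
have mUy s : s \in U -> m s != y by move=> sU; rewrite -{1}my (inj_eq minj) Uy.
have npmC a b m' : near_perfect_matching e a b m' -> near_perfect_matching e b a m'.
  by case=> ? ? ? h; split=> // z zb za; apply: h.
have rot s : s \in U -> exists m', near_perfect_matching e (m s) y m' /\
    forall u, u != s -> u != x -> u != m s -> m' u = m u.
  move=> sU; apply: (rotate esym eirr npm_m xy _ (Ux s sU) (Uy s sU)).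
  by rewrite Ue // eq_sym Ux.
have mUyN s : s \in U -> ~~ e (m s) y.
  by move=> sU; have [m' [npm' _]] := rot s sU; apply: noadj npm'; apply: mUy.
have mUxN s : s \in U -> ~~ e (m s) x.
  move=> sU; have yx : y != x by rewrite eq_sym.
  have esy : e s y by rewrite Ue // eq_sym Uy.
  have [m' [npm' _]] := rotate esym eirr (npmC _ _ _ npm_m) yx esy (Uy s sU) (Ux s sU).
  by apply: noadj npm'; apply: mUx.
have mUU s : s \in U -> m s \notin U.
  by move=> sU; apply: nUe (mUyN s sU); apply: mUy.
have mUmU s s' : s \in U -> s' \in U -> s != s' -> ~~ e (m s') (m s).
  move=> sU s'U ss'; have [m' [npm' m'E]] := rot s sU.
  have s'ms : s' != m s by apply: contraNneq (mUU s sU) => <-.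
  have ymsn : y != m s by rewrite eq_sym mUy.
  have es'y : e s' y by rewrite Ue // eq_sym Uy.
  have [m2 [npm2 _]] := rotate esym eirr (npmC _ _ _ npm') ymsn es'y (Uy s' s'U) s'ms.
  have E : m' s' = m s' by apply: m'E => //; [rewrite eq_sym | apply: Ux].
  move: npm2; rewrite E.
  by move=> /noadj; apply; rewrite (inj_eq minj) eq_sym.
have ZP z : z \in Z -> [\/ z = x, z = y | exists2 s, s \in U & z = m s].
  rewrite !inE => /or3P[/eqP|/eqP|/imsetP]; by [constructor 1|constructor 2|constructor 3].
have ZN u v : u \in Z -> v \in Z -> u != v -> ~~ e u v.
  case/ZP=> [->|->|[s sU ->]]; case/ZP=> [->|->|[s' s'U ->]]; rewrite ?eqxx //.
  - by rewrite esym mUxN.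
  - by rewrite esym.
  - by rewrite esym mUyN.
  - by rewrite mUxN.
  - by rewrite mUyN.
  by rewrite (inj_eq minj) eq_sym => ss'; apply: mUmU.
have ZU z : z \in Z -> z \notin U by case/ZP=> [->|->|[s sU ->]] //; apply: mUU.
have cinj : {in Z &, injective c}.
  move=> u v uZ vZ cuv; apply/eqP/negPn/negP => uv.
  by case/negP: (ZN u v uZ vZ uv); apply: cadj => //; apply: ZU.
have mZ s : s \in U -> m s \in Z by move=> sU; rewrite !inE imset_f ?orbT.
have cardZ : #|Z| = #|U|.+2.
  rewrite !cardsU1 card_imset // !inE negb_or xy.
  have -> : x \notin [set m s | s in U].
    by apply/imsetP => -[s sU E]; move: (mUx s sU); rewrite -E eqxx.
  suff -> : y \notin [set m s | s in U] by [].
  by apply/imsetP => -[s sU E]; move: (mUy s sU); rewrite -E eqxx.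
exists U, c; split=> //.
apply: (@leq_trans #|c @: Z|); first by rewrite card_in_imset // cardZ ltnS leqnSn.
apply/subset_leq_card/subsetP => _ /imsetP[z zZ ->]; rewrite inE.
have zL : z \in label_class U c (c z) by rewrite inE ZU //= eqxx.
rewrite (cardsD1 z) zL /=; apply: (even_fixfree_involution mK) => w.
rewrite !inE => /and3P[wz wU /eqP cwz].
have wZ : w \notin Z by apply: contra wz => wZ; apply/eqP/cinj.
have wx : w != x by apply: contraNneq wZ => ->; rewrite !inE eqxx.
have wy : w != y by apply: contraNneq wZ => ->; rewrite !inE eqxx orbT.
have ewm := me w wx wy.
have mwU : m w \notin U by apply: contra wZ => /mZ; rewrite mK.
rewrite mwU -cwz (cE w (m w)) // eqxx !andbT; split; last first.
  by apply: contraTneq ewm => ->; rewrite eirr.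
apply: contraNneq wU => E; case/ZP: zZ E => [->|->|[s sU ->]] E.
- by case/eqP: wx; rewrite -(mK w) E.
- by case/eqP: wy; rewrite -(mK w) E.
by rewrite (minj _ _ E).
Qed.

(** A barrier survives deleting edges, so by induction on the number of
    non-adjacent pairs it may be assumed that adding any edge creates a
    perfect matching.  Then either adjacency is transitive outside the
    universal vertices, or two of the new matchings can be switched. *)
Theorem tutte e : symmetric e -> irreflexive e ->
  (exists m, perfect_matching e m) \/ exists U c, barrier e U c.
Proof.
pose gap e' := #|[set p : T * T | ~~ e' p.1 p.2]|.
elim: {e}(gap e).+1 {-2}e (ltnSn (gap e)) => // n IHn e gap_e esym eirr.
have [pm|npm] := pselect (exists m, perfect_matching e m); first by left.
have [[x [z [xz nexz nadd]]]|add] := pselect (exists x z, [/\ x != z, ~~ e x z &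
    ~ exists m, perfect_matching (add_edge e x z) m]).
  have sub u v : e u v -> add_edge e x z u v by rewrite /add_edge => ->.
  have [||||[U [c [cE cU]]]] := IHn (add_edge e x z).
  - rewrite ltnS in gap_e; apply: (leq_trans _ gap_e); apply: proper_card; apply/properP; split.
      by apply/subsetP => p; rewrite !inE; apply: contra; apply: sub.
    by exists (x, z); rewrite !inE //= /add_edge !eqxx orbT.
  - by move=> u v; rewrite /add_edge esym; congr (_ || _); rewrite orbC; congr (_ || _); rewrite andbC.
  - by move=> u; rewrite /add_edge eirr /=; apply/negP => /orP[] /andP[/eqP -> /eqP E];
    by case/eqP: xz.
  - by [].
  right; exists U, c; split=> // u v uU vU euv.
  by apply: cE => //; apply: sub.
have pm_add x z : x != z -> ~~ e x z ->
    exists2 m, perfect_matching (add_edge e x z) m & m x = z.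
  move=> xz nexz.
  have [m pm] : exists m, perfect_matching (add_edge e x z) m.
    by apply/notP => nm; apply: add; exists x, z.
  exists m => //; apply/eqP/negPn/negP => mxz; apply: npm; exists m => u.
  have [mK] := pm u; rewrite /add_edge => /or3P[//||] /andP[/eqP E1 /eqP E2].
    by case/eqP: mxz; rewrite -E1 E2.
  by case/eqP: mxz; rewrite -E2 mK.
apply: clique_barrier => //.
  move=> x y z xz exy eyz nexz w wy; apply/negPn/negP => neyw; apply: npm.
  have yw : y != w by rewrite eq_sym.
  have [m1 pm1 m1x] := pm_add x z xz nexz.
  have [m2 pm2 m2y] := pm_add y w yw neyw.
  by apply: (switch_matchings esym _ eyz neyw xz yw pm1 m1x pm2 m2y eirr); rewrite esym.
move=> x y xy nexy; have [m pm mx] := pm_add x y xy nexy.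
have mK := fun u => (pm u).1; have my : m y = x by rewrite -mx mK.
exists (fun v => if v == x then x else if v == y then y else m v); split.
- move=> v; have [->|vx] := eqVneq v x; first by rewrite eqxx.
  have [->|vy] := eqVneq v y; first by rewrite eqxx eq_sym (negPf xy).
  have -> : (m v == x) = (v == y) by rewrite -my (inj_eq (can_inj mK)).
  have -> : (m v == y) = (v == x) by rewrite -mx (inj_eq (can_inj mK)).
  by rewrite (negPf vx) (negPf vy) mK.
- by rewrite eqxx.
- by rewrite eqxx eq_sym (negPf xy).
move=> z /negPf zx /negPf zy; rewrite zx zy.
by have [_] := pm z; rewrite /add_edge zx zy !orbF.
Qed.

End Tutte.

(** * Parity of cardinals *)

Section OddCards.
Local Open Scope nat_scope.

Lemma odd_card_bigaddb (I : finType) (D : {set I}) :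
  odd #|D| = \big[addb/false]_(i : I) (i \in D).
Proof.
rewrite -sum1_card (big_morph odd oddD (erefl : odd 0 = false)) big_mkcond /=.
by apply: eq_bigr => i _; case: (i \in D).
Qed.

Lemma odd_card_symdiff (I : finType) (D D' : {set I}) :
  odd #|[set i | (i \in D) (+) (i \in D')]| = odd #|D| (+) odd #|D'|.
Proof.
rewrite !odd_card_bigaddb -big_split /=.
by apply: eq_bigr => i _; rewrite inE.
Qed.

Lemma card_sum_nat (I : finType) (D : {set I}) (P : pred I) :
  #|[set i in D | P i]| = \sum_(i in D) (P i : nat).
Proof.
rewrite -sum1dep_card big_mkcondr /=.
by apply: eq_bigr => i _; case: (P i).
Qed.

Lemma odd_card_cap_pair (I : finType) (x y : I) (D : {set I}) :
  x != y -> odd #|D :&: [set x; y]| = (x \in D) (+) (y \in D).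
Proof.
move=> xy; rewrite odd_card_bigaddb (bigD1 x) //= (bigD1 y) 1?eq_sym //= big1 => [|z /andP[zx zy]].
  by rewrite !inE !eqxx orbT !andbT addbF.
by rewrite !inE (negPf zx) (negPf zy) andbF.
Qed.

End OddCards.

(** * Cuts, degrees and components *)

Section Cuts.
Local Open Scope nat_scope.
Variable G : multigraph.
Implicit Types (e : edge G) (u v w : vertex G) (F C W X : {set edge G})
  (A Y : {set vertex G}).

Definition cut A : {set edge G} := [set e | #|ends e :&: A| == 1].

Definition inner_edges F Y : {set edge G} := [set e in F | ends e \subset Y].

(** [Y] is a union of components of the subgraph with edge set [F]. *)
Definition edge_closed F Y := [disjoint F & cut Y].

Lemma endsP e : exists u v, u != v /\ ends e = [set u; v].
Proof. by have /eqP/cards2P[u [v [uv eE]]] := card_ends e; exists u, v. Qed.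

Lemma end_other e v : v \in ends e -> exists2 u, u != v & ends e = [set v; u].
Proof.
have [u [w [uw ->]]] := endsP e; rewrite !inE => /orP[] /eqP ->.
  by exists w; rewrite // eq_sym.
by exists u => //; rewrite setUC.
Qed.

Lemma in_cut e u v A : u != v -> ends e = [set u; v] ->
  (e \in cut A) = (u \in A) (+) (v \in A).
Proof.
move=> uv eE; rewrite inE eE.
have [uA|uA] := boolP (u \in A); have [vA|vA] := boolP (v \in A).
- have -> : [set u; v] :&: A = [set u; v].
    by apply/setIidPl/subsetP => w; rewrite !inE => /orP[] /eqP ->.
  by rewrite cards2 uv.
- have -> : [set u; v] :&: A = [set u]; last by rewrite cards1.
  apply/setP => w; rewrite !inE; have [->|wu] := eqVneq w u; first by rewrite uA.
  by have [->|//] := eqVneq w v; rewrite (negPf vA).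
- have -> : [set u; v] :&: A = [set v]; last by rewrite cards1.
  apply/setP => w; rewrite !inE orbC; have [->|wu] := eqVneq w v; first by rewrite vA.
  by have [->|//] := eqVneq w u; rewrite (negPf uA).
have -> : [set u; v] :&: A = set0; last by rewrite cards0.
apply/setP => w; rewrite !inE; have [->|wu] := eqVneq w u; first by rewrite (negPf uA).
by have [->|//] := eqVneq w v; rewrite (negPf vA).
Qed.

Definition symdiff A Y : {set vertex G} := [set v | (v \in A) (+) (v \in Y)].

Lemma cut_symdiff A Y e : (e \in cut (symdiff A Y)) = (e \in cut A) (+) (e \in cut Y).
Proof.
have [u [v [uv eE]]] := endsP e; rewrite !(in_cut _ uv eE) !inE.
by case: (u \in A); case: (u \in Y); case: (v \in A); case: (v \in Y).
Qed.

Lemma cut1 v : cut [set v] = [set e | v \in ends e].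
Proof.
apply/setP => e; have [u [w [uw eE]]] := endsP e.
rewrite (in_cut _ uw eE) !inE eE !inE ![v == _]eq_sym.
have [uv|_] := eqVneq u v; have [wv|_] := eqVneq w v => //.
by move: uw; rewrite uv wv eqxx.
Qed.

Lemma cutC A : cut (~: A) = cut A.
Proof.
apply/setP => e; have [u [w [uw eE]]] := endsP e.
by rewrite !(in_cut _ uw eE) !inE; case: (u \in A); case: (w \in A).
Qed.

Lemma degree_sum F Y :
  \sum_(v in Y) degree F v = \sum_(e in F) #|ends e :&: Y|.
Proof.
under eq_bigr => v _ do rewrite /degree card_sum_nat.
rewrite exchange_big /=; apply: eq_bigr => e _; rewrite -card_sum_nat.
by congr #|pred_of_set _|; apply/setP => v; rewrite !inE andbC.
Qed.

Lemma degree_total F : \sum_v degree F v = #|F|.*2.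
Proof.
have := degree_sum F [set: vertex G]; rewrite (eq_bigl xpredT) => [->|v]; last by rewrite inE.
under eq_bigr => e _ do rewrite setIT card_ends.
by rewrite sum_nat_const muln2.
Qed.

Lemma ends_cap_cut e A : odd #|ends e :&: A| = (e \in cut A).
Proof.
have le2 : #|ends e :&: A| <= 2 by rewrite -(card_ends e) subset_leq_card ?subsetIl.
by rewrite inE; case: #|_| le2 => [|[|[|]]].
Qed.

(** Modulo 2, edges inside [A] are counted twice by the degrees. *)
Lemma odd_cut_sum F A : odd (\sum_(v in A) degree F v) = odd #|F :&: cut A|.
Proof.
rewrite degree_sum; have -> : F :&: cut A = [set e in F | e \in cut A].
  by apply/setP => e; rewrite !inE.
rewrite -sum1dep_card big_mkcondr /=.
elim/big_rec2: _ => // e n1 n2 eF; rewrite !oddD => ->.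
by rewrite ends_cap_cut; case: (e \in cut A).
Qed.

Lemma edge_closedP F Y : reflect
  (forall e u v, e \in F -> u \in ends e -> v \in ends e -> u \in Y -> v \in Y)
  (edge_closed F Y).
Proof.
apply: (iffP pred0P) => [cl e u v eF ue ve uY | cl e].
  have [->//|vu] := eqVneq v u.
  have eE : ends e = [set u; v].
    have [w wu eE] := end_other ue; move: ve; rewrite eE !inE (negPf vu) /=.
    by move/eqP ->.
  have := cl e; rewrite /= eF (in_cut _ _ eE) 1?eq_sym // uY.
  by case: (v \in Y).
rewrite /=; have [eF|//] := boolP (e \in F).
have [u [v [uv eE]]] := endsP e; rewrite (in_cut _ uv eE).
have ue : u \in ends e by rewrite eE !inE eqxx.
have ve : v \in ends e by rewrite eE !inE eqxx orbT.
have uvY := cl e u v eF ue ve; have vuY := cl e v u eF ve ue.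
by apply/negbTE; rewrite addbC; case: (u \in Y) uvY vuY; case: (v \in Y) => // H K; rewrite ?H ?K.
Qed.

Lemma card_inner_edges F Y : edge_closed F Y ->
  \sum_(v in Y) degree F v = (#|inner_edges F Y|).*2.
Proof.
move=> /edge_closedP cl; rewrite degree_sum (big_setID (inner_edges F Y)) /=.
have -> : F :&: inner_edges F Y = inner_edges F Y.
  by apply/setIidPr/subsetP => e; rewrite inE => /andP[].
rewrite [X in _ + X]big1 ?addn0 => [|e].
  rewrite -muln2 -sum_nat_const; apply: eq_bigr => e.
  by rewrite inE => /andP[_ /setIidPl ->]; rewrite card_ends.
rewrite !inE => /andP[nin eF]; move: nin; rewrite eF /= => /subsetPn[u ue uY].
apply/eqP; rewrite cards_eq0; apply/eqP/setP => v; rewrite !inE.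
apply/negP => /andP[ve vY]; case/negP: uY; exact: (cl e v u).
Qed.

Lemma adjacentP F u v :
  reflect (u != v /\ exists2 e, e \in F & ends e = [set u; v]) (adjacent F u v).
Proof.
apply: (iffP andP) => -[uv].
  by case/existsP=> e /andP[eF /eqP eE]; split=> //; exists e.
by case=> e eF eE; split=> //; apply/existsP; exists e; rewrite eF eE /=.
Qed.

Lemma adjacent_sym F : symmetric (adjacent F).
Proof.
by move=> u v; rewrite /adjacent eq_sym; congr (_ && _); apply: eq_existsb => e; rewrite setUC.
Qed.

Lemma adjacentS F C : F \subset C -> subrel (adjacent F) (adjacent C).
Proof.
move=> /subsetP FC u v /adjacentP[uv [e eF eE]].
by apply/adjacentP; split=> //; exists e => //; apply: FC.
Qed.

Lemma edge_closed_connect F Y u v :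
  edge_closed F Y -> connect (adjacent F) u v -> u \in Y -> v \in Y.
Proof.
move=> /edge_closedP cl /connectP[p]; elim: p u => [u _ -> //|w p IHp u] /=.
case/andP=> /adjacentP[_ [e eF eE]] pw vp uY; apply: (IHp w) => //.
by apply: cl eF _ _ uY; rewrite eE !inE eqxx ?orbT.
Qed.

Definition component F v := [set u | connect (adjacent F) v u].

Lemma component_closed F v : edge_closed F (component F v).
Proof.
apply/edge_closedP => e u w eF ue we; rewrite !inE => vu.
have [->//|wu] := eqVneq w u.
apply: connect_trans vu _; apply: connect1; apply/adjacentP; rewrite eq_sym; split=> //.
exists e => //; have [x xu eE] := end_other ue; move: we; rewrite eE !inE (negPf wu).
by move/eqP ->.
Qed.

Lemma component_id F v : v \in component F v.
Proof. by rewrite inE connect0. Qed.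

End Cuts.

(** * Circuits of a 2-factor *)

Section TwoFactors.
Local Open Scope nat_scope.
Variables (G : multigraph) (F : {set edge G}).
Hypothesis F2 : factor 2 F.
Implicit Types (e : edge G) (u v w : vertex G) (C X : {set edge G})
  (Y : {set vertex G}).

Let degF v : degree F v = 2. Proof. by move/forallP: F2 => /(_ v)/eqP. Qed.

Lemma card_inner_2factor Y : edge_closed F Y -> #|inner_edges F Y| = #|Y|.
Proof.
move=> cl; apply: double_inj; rewrite -card_inner_edges //.
by under eq_bigr => v _ do rewrite degF; rewrite sum_nat_const muln2.
Qed.

Lemma degree_inner Y v : edge_closed F Y ->
  degree (inner_edges F Y) v = (v \in Y).*2.
Proof.
move=> /edge_closedP cl; have [vY|vY] := boolP (v \in Y).
  transitivity (degree F v); last by rewrite degF.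
  congr #|pred_of_set _|; apply/setP => e; rewrite !inE.
  have [eF|] //= := boolP (e \in F); have [ve|] := boolP (v \in ends e); rewrite ?andbF //.
  by rewrite andbT; apply/subsetP => u ue; apply: (cl e v).
apply/eqP; rewrite cards_eq0; apply/eqP/setP => e; rewrite !inE.
by apply/negP => /andP[/andP[_ /subsetP sub] /sub]; apply/negP.
Qed.

Lemma component_circuit v : circuit (inner_edges F (component F v)).
Proof.
have cl := component_closed F v; set C := inner_edges _ _.
have degC w := degree_inner w cl.
have compC w : w \in component F v -> connect (adjacent C) v w.
  move=> vw; suff: w \in component C v by rewrite inE.
  move: vw; rewrite inE => /edge_closed_connect; apply; last exact: component_id.
  apply/edge_closedP => e a b eF ae be; rewrite !inE => va.
  have aK : a \in component F v.
    by rewrite inE; apply: connect_sub va => x y xy; apply: connect1;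
      apply: adjacentS xy; apply/subsetP => ?; rewrite inE => /andP[].
  have [->//|ba] := eqVneq b a.
  apply: connect_trans va _; apply: connect1; apply/adjacentP; rewrite eq_sym; split=> //.
  exists e.
    rewrite inE eF; apply/subsetP => x xe.
    by move/edge_closedP: cl => cl; apply: cl eF ae xe aK.
  have [x xu eE] := end_other ae; move: be; rewrite eE !inE (negPf ba).
  by move/eqP ->.
apply/and3P; split.
- have : 0 < degree C v by rewrite degC component_id.
  by rewrite card_gt0 => /set0Pn[e]; rewrite inE => /andP[eC _]; apply/set0Pn; exists e.
- by apply/forallP => w; rewrite degC; case: (w \in _).
apply/forallP => u; apply/forallP => w; apply/implyP; rewrite !degC => /andP[].
case uK: (u \in _) => // _; case wK: (w \in _) => // _.
apply: (connect_trans _ (compC w wK)).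
by rewrite (sym_connect_sym (@adjacent_sym G C)); apply: compC.
Qed.

Lemma circuit_edges_at C e e' v : C \subset F -> circuit C ->
  e \in C -> v \in ends e -> e' \in F -> v \in ends e' -> e' \in C.
Proof.
move=> CF /and3P[_ /forallP/(_ v) degC _] eC ve e'F ve'.
have sub : [set e in C | v \in ends e] \subset [set e in F | v \in ends e].
  by apply/subsetP => x; rewrite !inE => /andP[/(subsetP CF) -> ->].
have degCv : degree C v = 2.
  have : 0 < degree C v by apply/card_gt0P; exists e; rewrite inE eC.
  by case/orP: degC => /eqP ->.
have /eqP E : [set e in C | v \in ends e] == [set e in F | v \in ends e].
  by rewrite eqEcard sub; move: (degF v) degCv; rewrite /degree => -> ->.
have : e' \in [set e in F | v \in ends e] by rewrite inE e'F.
by rewrite -E inE => /andP[].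
Qed.

(** A circuit uses both edges of [F] at each of its vertices, so nothing of
    the component is left out. *)
Lemma circuitE C e v : C \subset F -> circuit C -> e \in C -> v \in ends e ->
  C = inner_edges F (component F v).
Proof.
move=> CF circC eC ve; have /and3P[_ _ /forallP conC] := circC.
have deg_pos x w : x \in C -> w \in ends x -> 0 < degree C w.
  by move=> xC wx; apply/card_gt0P; exists x; rewrite inE xC.
apply/setP => x; rewrite inE; apply/idP/andP => [xC|[xF /subsetP xK]].
  split; first exact: (subsetP CF).
  apply/subsetP => w wx; rewrite inE.
  have /implyP := forallP (conC v) w; rewrite (deg_pos e) // (deg_pos x) // => /(_ isT).
  apply: connect_sub => a b ab; apply: connect1; exact: adjacentS ab.
pose Z := [set w | [exists y in C, w \in ends y]].
have [w [w' [_ xE]]] := endsP x; have wx : w \in ends x by rewrite xE !inE eqxx.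
have : w \in Z.
  move: (xK w wx); rewrite inE => /edge_closed_connect; apply.
    apply/edge_closedP => y a b yF ay by_; rewrite !inE.
    case/existsP=> z /andP[zC az]; apply/existsP; exists y.
    by rewrite by_ andbT (circuit_edges_at CF circC zC az).
  by rewrite inE; apply/existsP; exists e; rewrite eC.
rewrite inE => /existsP[y /andP[yC wy]].
exact: (circuit_edges_at CF circC yC wy).
Qed.

Lemma circuit_eq C C' e : C \subset F -> circuit C -> C' \subset F -> circuit C' ->
  e \in C -> e \in C' -> C = C'.
Proof.
have [u [v [_ eE]]] := endsP e; have ue : u \in ends e by rewrite eE !inE eqxx.
move=> CF cC C'F cC' eC eC'.
by rewrite (circuitE CF cC eC ue) (circuitE C'F cC' eC' ue).
Qed.

(** The condition is imposed on even circuits too: [X] avoids them, the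
    boolean [odd #|C|] being read as a number. *)
Definition odd_transversal X :=
  X \subset F /\ forall C, C \subset F -> circuit C -> #|X :&: C| = odd #|C|.

(** Each component inside [Y] is a circuit with as many vertices as edges, and
    contributes an edge of [X] exactly when it is odd. *)
Lemma transversal_inner X Y : odd_transversal X -> edge_closed F Y ->
  odd #|inner_edges X Y| = odd #|Y|.
Proof.
move=> [XF XC]; elim: {Y}_.+1 {-2}Y (ltnSn #|Y|) => // n IHn Y leY clY.
have [->|[v vY]] := set_0Vmem Y.
  suff -> : inner_edges X set0 = set0 by rewrite !cards0.
  apply/setP => e; rewrite !inE subset0 -cards_eq0 card_ends andbF //.
have [K KE] : exists K, K = component F v by exists (component F v).
have clK : edge_closed F K by rewrite KE; apply: component_closed.
have KY : K \subset Y.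
  by apply/subsetP => w; rewrite KE inE => /edge_closed_connect; apply.
have vK : v \in K by rewrite KE component_id.
have clYK : edge_closed F (Y :\: K).
  move/edge_closedP: clY => clY; move/edge_closedP: clK => clK.
  apply/edge_closedP => e a b eF ae be; rewrite !inE => /andP[aK aY].
  by rewrite (clY e a b) // andbT; apply: contra aK; apply: clK eF be ae.
have cardY : #|Y| = #|K| + #|Y :\: K| by rewrite -(cardsID K Y) (setIidPr KY).
have -> : inner_edges X Y = (X :&: inner_edges F K) :|: inner_edges X (Y :\: K).
  apply/setP => e; rewrite !inE; have [eX|] //= := boolP (e \in X).
  have eF : e \in F by apply: (subsetP XF).
  rewrite eF /=; have [u [w [_ eE]]] := endsP e.
  have ue : u \in ends e by rewrite eE !inE eqxx.
  have we : w \in ends e by rewrite eE !inE eqxx orbT.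
  have uw : (u \in K) = (w \in K).
    by move/edge_closedP: clK => clK; apply/idP/idP; apply: clK eF _ _.
  have sub2 (A : {set vertex G}) : (ends e \subset A) = (u \in A) && (w \in A).
    by rewrite eE subUset !sub1set.
  rewrite !sub2 !inE uw; have [wK|wK] //= := boolP (w \in K).
  by rewrite (subsetP KY w) // (subsetP KY u) // uw.
rewrite cardsU (_ : _ :&: inner_edges X _ = set0) ?cards0 ?subn0.
  rewrite cardY !oddD XC ?oddb ?card_inner_2factor //.
  - congr (_ (+) _); apply: IHn => //; move: leY; rewrite cardY.
    by rewrite (cardsD1 v K) vK; lia.
  - by apply/subsetP => e; rewrite inE => /andP[].
  by rewrite KE; apply: component_circuit.
apply/setP => e; rewrite !inE; apply/negP => /and3P[/and3P[_ _ eK] _ /subsetP eYK].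
have [u [w [_ eE]]] := endsP e; have ue : u \in ends e by rewrite eE !inE eqxx.
by have := eYK u ue; rewrite !inE (subsetP eK u ue).
Qed.

Lemma odd_circuitsP C :
  reflect [/\ C \subset F, circuit C & odd #|C|] (C \in odd_circuits F).
Proof. by rewrite inE; apply: and3P. Qed.

Lemma choice_transversal (q : {set edge G} -> edge G) :
  (forall C, C \in odd_circuits F -> q C \in C) ->
  odd_transversal (q @: odd_circuits F) /\
  #|q @: odd_circuits F| = #|odd_circuits F|.
Proof.
move=> qP; have qeq C C' : C \in odd_circuits F -> C' \subset F -> circuit C' ->
    q C \in C' -> C = C'.
  by move=> CO C'F cC'; have [CF cC _] := odd_circuitsP _ CO; apply: circuit_eq (qP C CO).
split; last first.
  apply: card_in_imset => C C' CO C'O E; have [C'F cC' _] := odd_circuitsP _ C'O.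
  by apply: qeq => //; rewrite E; apply: qP.
split; first by apply/subsetP => _ /imsetP[C CO ->]; have [/subsetP CF _ _] := odd_circuitsP _ CO; apply/CF/qP.
move=> C CF cC; have [oddC|evenC] := boolP (odd #|C|).
  have CO : C \in odd_circuits F by apply/odd_circuitsP.
  transitivity #|[set q C]|; last by rewrite cards1.
  congr #|pred_of_set _|; apply/setP => e; rewrite !inE.
  apply/andP/eqP => [[/imsetP[C' C'O ->] eC]|->]; first by rewrite (qeq C' C).
  by rewrite imset_f ?qP.
apply/eqP; rewrite cards_eq0; apply/eqP/setP => e; rewrite !inE; apply/negP => /andP[].
case/imsetP=> C' C'O -> eC; case/negP: evenC; rewrite -(qeq C' C) //.
by have [] := odd_circuitsP _ C'O.
Qed.

Lemma transversal_circuit X e : odd_transversal X -> e \in X ->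
  exists C, [/\ C \subset F, circuit C & X :&: C = [set e]].
Proof.
move=> [XF XC] eX; have [u [v [_ eE]]] := endsP e.
have CF : inner_edges F (component F u) \subset F.
  by apply/subsetP => x; rewrite inE => /andP[].
exists (inner_edges F (component F u)); split=> //; first exact: component_circuit.
have eI : e \in X :&: inner_edges F (component F u).
  have eF := subsetP XF e eX; rewrite !inE eX eF /=; apply/subsetP => w we.
  have /edge_closedP cl := component_closed F u.
  by apply: cl eF _ we (component_id F u); rewrite eE !inE eqxx.
have := XC _ CF (component_circuit u).
have : 0 < #|X :&: inner_edges F (component F u)| by apply/card_gt0P; exists e.
case: (odd _) => // [_ /eqP/cards1P[x E]|]; last by case: #|_|.
by move: eI; rewrite E inE => /eqP ->.
Qed.

Lemma transversal_circuit_uniq X e x C : odd_transversal X ->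
  C \subset F -> circuit C -> e \in X -> e \in C -> x \in X -> x \in C -> x = e.
Proof.
move=> XT CF cC eX eC xX xC; have [C' [C'F cC' E]] := transversal_circuit XT eX.
have eC' : e \in C' by have := set11 e; rewrite -E inE => /andP[].
have : x \in X :&: C' by rewrite -(circuit_eq CF cC C'F cC' eC eC') inE xX.
by rewrite E inE => /eqP.
Qed.

Lemma odd_circuit_edges C : C \in odd_circuits F -> exists e, e \in C.
Proof. by case/odd_circuitsP=> _ /and3P[/set0Pn[e eC]]; exists e. Qed.

End TwoFactors.
Arguments odd_circuitsP {G F C}.

(** * Linear systems over the field with two elements *)

Section ParitySystems.
Variables (V E : finType) (a : V -> E -> bool) (b : V -> bool).

Let natF2 n : n%:R = (odd n)%:R :> 'F_2.
Proof.
rewrite -{1}(odd_double_half n) natrD -muln2 natrM.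
by rewrite (_ : 2%:R = 0 :> 'F_2) ?mulr0 ?addr0 //; apply/eqP.
Qed.

Let eqF2 (x : 'F_2) : x = (x != 0)%:R.
Proof. by case: x => -[|[|m]] // i; apply/eqP. Qed.

Let sumF2 (I : finType) (P Q : pred I) :
  \sum_(i : I) (P i)%:R * (Q i)%:R = (odd #|[set i | P i & Q i]|)%:R :> 'F_2.
Proof.
rewrite -natF2 -sum1dep_card natr_sum [RHS]big_mkcond /=; apply: eq_bigr => i _.
by rewrite -natrM mulnb; case: (_ && _).
Qed.

(** Fredholm alternative: the system is solvable unless some combination [Y] of its
    equations has zero left-hand side and right-hand side 1.  The vectors
    [Y] to be tested are the columns of the cokernel matrix. *)
Lemma parity_system :
  (forall Y : {set V}, (forall e, ~~ odd #|[set v in Y | a v e]|) ->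
     ~~ odd #|[set v in Y | b v]|) ->
  exists y : {set E}, forall v, odd #|[set e in y | a v e]| = b v.
Proof.
move=> alt.
pose A : 'M['F_2]_(#|E|, #|V|) := \matrix_(i, j) (a (enum_val j) (enum_val i))%:R.
pose B : 'rV['F_2]_#|V| := \row_j (b (enum_val j))%:R.
have : (B <= A)%MS.
  rewrite submxE; apply/eqP/rowP => k; rewrite [RHS]mxE.
  pose u j := cokermx A j k; pose Y := [set v | u (enum_rank v) != 0].
  have uE v : u (enum_rank v) = (v \in Y)%:R by rewrite inE -eqF2.
  have := alt Y; rewrite !mxE.
  rewrite (reindex_onto enum_rank enum_val) => [|j _]; last exact: enum_valK.
  rewrite (eq_bigr (fun v => (b v)%:R * (v \in Y)%:R)) => [|v _]; last first.
    by rewrite mxE enum_rankK -uE.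
  rewrite (eq_bigl xpredT) => [|v]; last by rewrite enum_rankK eqxx.
  rewrite sumF2 => H; have -> : odd #|[set i | b i & i \in Y]| = false; last by [].
  apply/negbTE; have -> : [set i | b i & i \in Y] = [set v in Y | b v].
    by apply/setP => v; rewrite !inE andbC.
  apply: H => e; have := congr1 (fun M : 'M_(_, _) => M (enum_rank e) k) (mulmx_coker A).
  rewrite !mxE (reindex_onto enum_rank enum_val) => [|j _]; last exact: enum_valK.
  rewrite (eq_bigr (fun v => (a v e)%:R * (v \in Y)%:R)) => [|v _]; last first.
    by rewrite mxE !enum_rankK -uE.
  rewrite (eq_bigl xpredT) => [|v]; last by rewrite enum_rankK eqxx.
  rewrite sumF2 => H; have -> : [set v in Y | a v e] = [set i | a i e & i \in Y].
    by apply/setP => v; rewrite !inE andbC.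
  by case: (odd _) H.
case/submxP=> D DE; pose y := [set e | D 0 (enum_rank e) != 0].
have yE e : D 0 (enum_rank e) = (e \in y)%:R by rewrite inE -eqF2.
exists y => v; have := congr1 (fun M : 'rV_ _ => M 0 (enum_rank v)) DE.
rewrite !mxE enum_rankK (reindex_onto enum_rank enum_val) => [|j _]; last exact: enum_valK.
rewrite (eq_bigr (fun e => (e \in y)%:R * (a v e)%:R)) => [|e _]; last first.
  by rewrite mxE !enum_rankK -yE.
rewrite (eq_bigl xpredT) => [|e]; last by rewrite enum_rankK eqxx.
by rewrite sumF2; case: (b v); case: (odd _).
Qed.

End ParitySystems.

Section Matchings.
Local Open Scope nat_scope.
Variable G : multigraph.
Implicit Types (e : edge G) (u v : vertex G) (M N : {set edge G}).

(** An obstruction would be an odd set of edges with even degree at every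
    vertex; but such a set has equally many edges in both matchings. *)
Lemma two_matchings_bipartite M N : [disjoint M & N] ->
  (forall v, degree M v <= 1) -> (forall v, degree N v <= 1) ->
  exists p : {set vertex G}, M :|: N \subset cut p.
Proof.
move=> dMN degM degN.
pose a e v := (e \in M :|: N) && (v \in ends e).
have [|p pE] := @parity_system _ _ a (mem (M :|: N)).
  move=> Y Yeven /=.
  have -> : [set e in Y | e \in M :|: N] = (Y :&: M) :|: (Y :&: N).
    by apply/setP => e; rewrite !inE andb_orr.
  have YMN : (Y :&: M) :&: (Y :&: N) = set0.
    apply/setP => e; rewrite !inE; apply/negP => /andP[/andP[_ eM] /andP[_ eN]].
    by have := disjointFr dMN eM; rewrite eN.
  rewrite cardsU YMN cards0 subn0.
  suff -> : #|Y :&: M| = #|Y :&: N| by rewrite addnn odd_double.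
  apply: double_inj; rewrite -!degree_total; apply: eq_bigr => v _.
  have := Yeven v; have -> : [set e in Y | a e v] =
      [set e in Y :&: M | v \in ends e] :|: [set e in Y :&: N | v \in ends e].
    by apply/setP => e; rewrite /a !inE; case: (e \in Y) => //=; case: (e \in M);
       case: (e \in N); case: (v \in ends e).
  have dYMN : [set e in Y :&: M | v \in ends e] :&: [set e in Y :&: N | v \in ends e] = set0.
    apply/setP => e; have := congr1 (fun D : {set edge G} => e \in D) YMN; rewrite !inE.
    by case: (e \in Y); case: (e \in M); case: (e \in N); case: (v \in ends e).
  rewrite cardsU dYMN cards0 subn0.
  rewrite -!/(degree _ v).
  have degS (D D' : {set edge G}) : D \subset D' -> degree D v <= degree D' v.
    move=> /subsetP sD; apply/subset_leq_card/subsetP => e; rewrite !inE => /andP[/sD -> ->] //.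
  have := leq_trans (degS _ _ (subsetIr Y M)) (degM v).
  have := leq_trans (degS _ _ (subsetIr Y N)) (degN v).
  by case: (degree _ v) => [|[|]] //; case: (degree _ v) => [|[|]].
exists p; apply/subsetP => e eMN; rewrite -ends_cap_cut.
have <- : [set v in p | a e v] = ends e :&: p.
  by apply/setP => v; rewrite !inE /a eMN andbC.
by rewrite pE.
Qed.
End Matchings.

(** * Half-edges as pairs of an edge and an end *)

Section HalfEdges.
Variables (R : realType) (G : multigraph).
Implicit Types (e : edge G) (u v : vertex G) (sigma : signature G)
  (T : edge G -> vertex G -> bool) (f : edge G -> R).

Definition pair_orientation sigma T := forall e u v,
  u != v -> ends e = [set u; v] -> T e u (+) T e v = ~~ sigma e.

Definition on_half_edges T : half_edge G -> bool :=
  fun h => T (half_edge_edge h) (half_edge_vertex h).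

Lemma orientation_pairs sigma T :
  orientation sigma (on_half_edges T) <-> pair_orientation sigma T.
Proof.
have signE (a b c : bool) :
    ((-1) ^+ a * (-1) ^+ b = - (-1) ^+ c :> int) <-> a (+) b = ~~ c.
  by case: a; case: b; case: c.
split=> [ori e u v uv eE | ori h h' hh' E].
  have ue : u \in ends e by rewrite eE !inE eqxx.
  have ve : v \in ends e by rewrite eE !inE eqxx orbT.
  pose h : half_edge G := exist _ (e, u) ue; pose h' : half_edge G := exist _ (e, v) ve.
  have hh' : h != h' by rewrite -val_eqE /= xpair_eqE eqxx.
  exact/signE/(ori h h' hh' erefl).
apply/signE; rewrite /on_half_edges -E; apply: ori.
  apply: contraNneq hh' => E'; rewrite -val_eqE; apply/eqP.
  rewrite [val h]surjective_pairing [val h']surjective_pairing.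
  by congr (_, _).
have vh := valP h; have vh' := valP h'.
rewrite -/(half_edge_edge h) -/(half_edge_vertex h) in vh.
rewrite -/(half_edge_edge h') -/(half_edge_vertex h') -E in vh'.
have [w wv eE] := end_other vh; rewrite eE.
move: vh'; rewrite eE !inE => /orP[/eqP E'|/eqP -> //].
case/eqP: hh'; apply: val_inj.
rewrite [LHS]surjective_pairing [RHS]surjective_pairing.
by congr (_, _).
Qed.

Lemma boundary_pairs T f v :
  boundary (on_half_edges T) f v =
  \sum_(e | v \in ends e) (-1) ^+ T e v * f e.
Proof.
rewrite /boundary.
pose F (p : edge G * vertex G) : R := (-1) ^+ T p.1 p.2 * f p.1.
transitivity (\sum_(p : edge G * vertex G | (p.2 \in ends p.1) && (p.2 == v)) F p).
  rewrite (reindex_omap (val : half_edge G -> _) insub) /=; last first.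
    by move=> p /andP[pP _]; rewrite (insubT (fun h : edge G * vertex G => h.2 \in ends h.1) pP).
  by apply: eq_bigl => h; rewrite valK eqxx (valP h) andbT.
transitivity (\sum_(e | true) \sum_(u | (u \in ends e) && (u == v)) F (e, u)).
  by rewrite pair_big_dep.
rewrite [RHS]big_mkcond /=; apply: eq_bigr => e _; have [ve|ve] := ifPn.
  rewrite (eq_bigl (pred1 v)) ?big_pred1_eq // => u /=.
  by have [->|] := eqVneq u v; rewrite ?andbF ?ve.
by rewrite big_pred0 // => u; have [->|] := eqVneq u v; rewrite ?andbF // (negPf ve).
Qed.

Lemma half_edge_functionE (tau : half_edge G -> bool) :
  exists T, tau = on_half_edges T.
Proof.
exists (fun e v => if insub (e, v) is Some h then tau h else false).
apply: funext => h; rewrite /on_half_edges.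
by rewrite -surjective_pairing valK.
Qed.

End HalfEdges.

(** * Flows below 4 on cubic graphs *)

Section CubicFlows.
Variables (R : realType) (G : multigraph).
Hypothesis G_cubic : cubic G.
Implicit Types (e : edge G) (u v : vertex G) (sigma : signature G) (r : R)
  (T : edge G -> vertex G -> bool) (f : edge G -> R) (X : {set edge G}).

Definition antibalanced X := exists A, X = ~: cut A.

Lemma cubic_star e0 v : v \in ends e0 -> exists e1 e2,
  [/\ e1 != e0, e2 != e0, e1 != e2 & [set e | v \in ends e] = [set e0; e1; e2]].
Proof.
move=> ve0; have : #|[set e | v \in ends e]| = 3%N.
  by rewrite -(G_cubic v); congr #|pred_of_set _|; apply/setP => e; rewrite !inE.
rewrite (cardsD1 e0) inE ve0 => -[] /eqP/cards2P[e1 [e2 [e12 E]]].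
have : e1 \in [set e1; e2] by rewrite !inE eqxx.
rewrite -E !inE => /andP[e10 ve1].
have : e2 \in [set e1; e2] by rewrite !inE eqxx orbT.
rewrite -E !inE => /andP[e20 ve2].
exists e1, e2; split=> //; apply/setP => e.
have := congr1 (fun D : {set edge G} => e \in D) E; rewrite !inE.
by have [->|] //= := eqVneq e e0.
Qed.

Lemma sum_star (M : nmodType) (g : edge G -> M) v e0 e1 e2 :
  e1 != e0 -> e2 != e0 -> e1 != e2 -> [set e | v \in ends e] = [set e0; e1; e2] ->
  \sum_(e | v \in ends e) g e = g e0 + g e1 + g e2.
Proof.
move=> e10 e20 e12 E.
rewrite (eq_bigl (mem [set e0; e1; e2])) => [|e]; last first.
  by rewrite /= -E inE.
rewrite -setUA big_setU1 /=; last by rewrite !inE negb_or ![e0 == _]eq_sym e10.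
by rewrite big_setU1 /= ?inE // big_set1 addrA.
Qed.

Definition half_edge_value T f e v : R := (-1) ^+ T e v * f e.

Lemma norm_half_edge_value T f e v : `|half_edge_value T f e v| = `|f e|.
Proof. by rewrite normrM normrX normrN1 expr1n mul1r. Qed.

Definition pair_flow sigma r T f :=
  [/\ pair_orientation sigma T, forall e, 1 <= `|f e| <= r - 1 &
      forall v, \sum_(e | v \in ends e) half_edge_value T f e v = 0].

Lemma admits_pair_flow sigma r : admits_nz_flow sigma r ->
  exists T f, pair_flow sigma r T f.
Proof.
move=> [_ [tau [f [ori [rng bd] nz]]]]; have [T TE] := half_edge_functionE tau.
exists T, f; rewrite TE in ori bd; split; first exact/orientation_pairs.
  by move=> e; have [/eqP|//] := rng e; rewrite (negPf (nz e)).
by move=> v; have := bd v; rewrite boundary_pairs.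
Qed.

Lemma pair_flow_half_edges sigma r T f : pair_flow sigma r T f ->
  [/\ orientation sigma (on_half_edges T), flow (on_half_edges T) r f &
      nowhere_zero f].
Proof.
move=> [ori rng bd]; split.
- exact/orientation_pairs.
- by split=> [e|v]; [right | rewrite boundary_pairs].
by move=> e; have /andP[] := rng e; rewrite -normr_gt0; lra.
Qed.

(** Exactly one of three such numbers reaches 2 in absolute value, and the
    other two have the opposite sign; so the sign of the large one can be read
    off from [x] alone. *)
Lemma zero_sum_sign (x y z : R) :
  1 <= `|x| < 3 -> 1 <= `|y| < 3 -> 1 <= `|z| < 3 -> x + y + z = 0 ->
  [|| 2 <= x, 2 <= y | 2 <= z] = (if 2 <= `|x| then 0 < x else x < 0).
Proof.
have sgn (t : R) : 1 <= `|t| < 3 -> (1 <= t < 3) || (1 <= - t < 3).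
  by case: (ler0P t) => _ ->; rewrite ?orbT.
move=> hx /sgn hy /sgn hz s.
have [x0|x0] := ltrP 0 x.
  rewrite gtr0_norm // in hx *; case/andP: hx => x1 x3.
  have [x2|x2] /= := leP 2 x; first by [].
  rewrite [x < 0]lt_gtF //; apply/negbTE; rewrite negb_or -!ltNge; case/orP: hy => /andP[y1 y3];
    case/orP: hz => /andP[z1 z3]; apply/andP; split; lra.
rewrite ler0_norm // in hx *; case/andP: hx => x1 x3.
have [x2|x2] /= := leP 2 x; first by lra.
have [nx2|nx2] := leP 2 (- x).
  apply/negbTE; rewrite negb_or -!ltNge; case/orP: hy => /andP[y1 y3];
    case/orP: hz => /andP[z1 z3]; apply/andP; split; lra.
have -> : x < 0 by lra.
case/orP: hy => /andP[y1 y3]; case/orP: hz => /andP[z1 z3]; first lra.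
- by apply/orP; left; lra.
- by apply/orP; right; lra.
lra.
Qed.

Lemma pair_flow_ge3 sigma r T f e : pair_flow sigma r T f -> 3 <= r.
Proof.
move=> [ori rng bd]; have [v [u [_ eE]]] := endsP e.
have ve : v \in ends e by rewrite eE !inE eqxx.
have [e1 [e2 [e10 e20 e12 E]]] := cubic_star ve.
have := bd v; rewrite (sum_star _ e10 e20 e12 E).
have := rng e; have := rng e1; have := rng e2.
rewrite -!(norm_half_edge_value T _ _ v).
move: (half_edge_value _ _ _ _) (half_edge_value _ _ _ _) (half_edge_value _ _ _ _) => x y z.
case: (ler0P x) => x0; case: (ler0P y) => y0; case: (ler0P z) => z0 /andP[? ?] /andP[? ?] /andP[? ?] ?; lra.
Qed.

(** The two half-edges of an edge carry opposite values if it is positive and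
    equal ones if it is negative; by [zero_sum_sign] this decides whether its
    ends lie on the same side of [A]. *)
Lemma pair_flow_lt4 sigma r T f : pair_flow sigma r T f -> r < 4 ->
  antibalanced (negative_edges sigma).
Proof.
move=> [ori rng bd] r4; pose w := half_edge_value T f.
pose A := [set v | [exists e, (v \in ends e) && (2 <= w e v)]].
have bnd e v : 1 <= `|w e v| < 3.
  by rewrite norm_half_edge_value; have := rng e; case/andP=> -> /=; lra.
have AE e v : v \in ends e -> (v \in A) = (if 2 <= `|f e| then 0 < w e v else w e v < 0).
  move=> ve; have [e1 [e2 [e10 e20 e12 E]]] := cubic_star ve.
  have := bd v; rewrite (sum_star _ e10 e20 e12 E).
  rewrite -(norm_half_edge_value T f e v) => /zero_sum_sign <-; try exact: bnd.
  rewrite inE; apply/existsP/or3P => [[x]|].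
    have -> : (v \in ends x) = (x \in [set e; e1; e2]) by rewrite -E inE.
    by rewrite !inE => /andP[/orP[/orP[]|]/eqP -> ?]; [constructor 1|constructor 2|constructor 3].
  have inE' x : x \in [set e; e1; e2] -> v \in ends x by rewrite -E inE.
  by case=> h; [exists e | exists e1 | exists e2]; rewrite inE' //= !inE eqxx ?orbT.
exists A; apply/setP => e; rewrite !inE; have [u [v [uv eE]]] := endsP e.
have ue : u \in ends e by rewrite eE !inE eqxx.
have ve : v \in ends e by rewrite eE !inE eqxx orbT.
have := in_cut A uv eE; rewrite inE => ->; rewrite (AE _ _ ue) (AE _ _ ve).
have f0 : f e != 0 by rewrite -normr_gt0; have /andP[? _] := rng e; lra.
have := ori e u v uv eE; rewrite /w /half_edge_value.
case: (sigma e); case: (T e u); case: (T e v) => //= _;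
  rewrite ?expr1 ?expr0 ?mulN1r ?mul1r; case: ifP => _; rewrite ?oppr_gt0 ?oppr_lt0;
  by case: ltrgt0P f0; rewrite ?eqxx.
Qed.

(** Give the half-edge of [M] at each vertex one sign and the other two the
    opposite sign, interchanged between [A] and its complement: then
    [2 - 1 - 1 = 0] everywhere. *)
Lemma antibalanced_flow3 sigma (M : {set edge G}) : factor 1 M ->
  antibalanced (negative_edges sigma) -> admits_nz_flow sigma (3 : R).
Proof.
move=> M1 [A AE].
pose T e v := (v \in A) (+) (e \in M).
pose f e : R := if e \in M then 2 else 1.
split; first by lra.
exists (on_half_edges T), f; apply: pair_flow_half_edges; split.
- move=> e u v uv eE; rewrite /T.
  have := congr1 (fun D : {set edge G} => e \in D) AE; rewrite [in X in _ = X]inE (in_cut _ uv eE) inE => ->.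
  by case: (u \in A); case: (v \in A); case: (e \in M).
- by move=> e; rewrite /f; case: ifP => _; rewrite ger0_norm; lra.
move=> v; have /forallP/(_ v)/cards1P[e ME] := M1.
have : e \in [set e in M | v \in ends e] by rewrite ME set11.
rewrite inE => /andP[eM ve]; have [e1 [e2 [e10 e20 e12 E]]] := cubic_star ve.
have notM x : x \in [set e; e1; e2] -> x != e -> x \notin M.
  rewrite -E inE => vx; apply: contra => xM.
  have : x \in [set e in M | v \in ends e] by rewrite inE xM.
  by rewrite ME inE.
rewrite (sum_star _ e10 e20 e12 E) /half_edge_value /T /f eM.
rewrite (negPf (notM e1 _ e10)) ?(negPf (notM e2 _ e20)) ?inE ?eqxx ?orbT //.
by case: (v \in A) => /=; lra.
Qed.

End CubicFlows.

(** * The 4-flow of an odd transversal *)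

Section TwoFactorSystems.
Local Open Scope nat_scope.
Variables (G : multigraph) (F X : {set edge G}).
Hypotheses (F2 : factor 2 F) (XT : odd_transversal F X).
Implicit Types (e : edge G) (u v : vertex G).

(** The values on [X] can be prescribed because complementing a solution on a
    whole circuit of [F] changes two terms of each equation or none. *)
Lemma two_factor_system (b : vertex G -> bool) (c : edge G -> bool) :
  (forall Y, edge_closed F Y -> ~~ odd #|[set v in Y | b v]|) ->
  exists y : {set edge G}, (forall v, odd (degree (y :&: F) v) = b v) /\
    (forall x, x \in X -> (x \in y) = c x).
Proof.
move=> bY; pose a v e := (e \in F) && (v \in ends e).
have [|y0 y0E] := @parity_system _ _ a b.
  move=> Y Yeven; apply: bY; apply/pred0P => e /=; apply/negbTE.
  rewrite negb_and -implybE; apply/implyP => eF; have := Yeven e.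
  rewrite -ends_cap_cut; congr (~~ odd #|pred_of_set _|).
  by apply/setP => v; rewrite !inE /a eF andbC.
pose W := [set e | [exists x in X, ((x \in y0) != c x) &&
  [exists C : {set edge G}, [&& C \subset F, circuit C, x \in C & e \in C]]]].
have WP e : reflect (exists x (C : {set edge G}), [/\ x \in X, (x \in y0) != c x, C \subset F, circuit C &
    (x \in C) && (e \in C)]) (e \in W).
  rewrite inE; apply: (iffP existsP) => [[x /and3P[xX xy /existsP[C /and4P[CF cC xC eC]]]]|].
    by exists x, C; rewrite xC.
  by case=> x [C [xX xy CF cC xeC]]; exists x; rewrite xX xy; apply/existsP; exists C; rewrite CF cC.
exists [set e | (e \in y0) (+) (e \in W)]; split=> [v|x xX]; last first.
  rewrite inE; have -> : (x \in W) = (x \in y0) (+) c x; last by case: (_ \in y0); case: (c x).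
  apply/WP/idP => [[z [C [zX zy CF cC /andP[zC xC]]]]|xy].
    by rewrite (transversal_circuit_uniq F2 XT CF cC zX zC xX xC); case: (_ \in y0) zy; case: (c z).
  have [C [CF cC E]] := transversal_circuit F2 XT xX.
  exists x, C; split=> //; first by case: (x \in y0) xy; case: (c x).
  by have := set11 x; rewrite -E inE => /andP[_ ->].
have -> : degree ([set e | (e \in y0) (+) (e \in W)] :&: F) v =
    #|[set e | (e \in [set e in y0 | a v e]) (+) (e \in [set e in W | a v e])]|.
  congr #|pred_of_set _|; apply/setP => e; rewrite !inE /a.
  by case: (e \in F); case: (v \in ends e); rewrite ?andbT ?andbF.
rewrite odd_card_symdiff y0E; suff -> : odd #|[set e in W | a v e]| = false by rewrite addbF.
have [->|[e]] := set_0Vmem [set e in W | a v e]; first by rewrite cards0.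
rewrite inE => /andP[/WP[x [C [xX xy CF cC /andP[xC eC]]]] /andP[eF ve]].
have -> : [set e in W | a v e] = [set e in F | v \in ends e].
  apply/setP => z; rewrite inE [RHS]inE; apply/andP/idP => [[]//|/andP[zF vz]].
  split; last exact/andP.
  apply/WP; exists x, C; split=> //; rewrite xC.
  by rewrite (circuit_edges_at F2 CF cC eC ve).
by rewrite -/(degree F v) (eqP (forallP F2 v)).
Qed.

End TwoFactorSystems.

Section FourFlows.
Variables (R : realType) (G : multigraph) (M X : {set edge G}).
Hypotheses (G_cubic : cubic G) (M1 : factor 1 M) (XT : odd_transversal (~: M) X).
Implicit Types (e : edge G) (u v : vertex G).

Lemma factor_compl : factor 2 (~: M).
Proof.
apply/forallP => v; have := G_cubic v; have := forallP M1 v; rewrite /degree => /eqP M1v.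
rewrite -(cardsID M) (_ : _ :&: M = [set e in M | v \in ends e]); last first.
  by apply/setP => e; rewrite !inE andbC.
rewrite M1v add1n (_ : _ :\: M = [set e in ~: M | v \in ends e]) => [[->]//|].
by apply/setP => e; rewrite !inE.
Qed.

Let F := ~: M.
Let F2 : factor 2 F := factor_compl.
Let XF : X \subset F := XT.1.

(** [s e] is the chosen end of [e], so [S] is the set of marked vertices.  The
    reference orientation [T] gives a positive edge sign -1 at [s e] and +1 at
    its other end, and a negative edge sign +1 at both. *)
Lemma transversal_flow4 : exists T (f : edge G -> R),
  pair_flow (signature_of X) 4 T f /\ forall e, f e \is a Num.int.
Proof.
have [s sP] : {s : edge G -> vertex G & forall e, s e \in ends e}.
  apply: (@boolp.choice _ _ (fun e (v : vertex G) => v \in ends e : Prop)) => e;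
  by have [u [v [_ eE]]] := endsP e; exists u; rewrite eE !inE eqxx.
have Xuniq x x' v : x \in X -> x' \in X -> v \in ends x -> v \in ends x' -> x = x'.
  move=> xX x'X vx vx'; have [C [CF cC E]] := transversal_circuit F2 XT xX.
  have xC : x \in C by have := set11 x; rewrite -E inE => /andP[].
  apply/esym/(transversal_circuit_uniq F2 XT CF cC xX xC x'X).
  exact: (circuit_edges_at F2 CF cC xC vx (subsetP XF _ x'X) vx').
pose S := [set s e | e in X].
pose T e v := (e \notin X) && (v == s e).
have ori : pair_orientation (signature_of X) T.
  move=> e u v uv eE; rewrite /T ffunE; have := sP e; rewrite eE !inE.
  case: (e \in X) => //=; case/orP=> /eqP ->; rewrite eqxx ?[v == u]eq_sym (negPf uv) //.
have evenS Y : edge_closed F Y -> odd #|Y :\: S| = false.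
  move=> cl; have := transversal_inner F2 XT cl; rewrite -(cardsID S Y) oddD.
  suff -> : Y :&: S = s @: inner_edges X Y.
    rewrite card_in_imset => [|x x' /[!inE] /andP[xX _] /andP[x'X _] E].
      by case: (odd _); case: (odd _).
    by apply: (Xuniq x x' (s x)) => //; rewrite E.
  apply/setP => v; rewrite !inE; apply/andP/imsetP => [[vY /imsetP[x xX vE]]|[x]].
    exists x => //; rewrite inE xX; apply/subsetP => w wx.
    move/edge_closedP: cl => cl; apply: cl (subsetP XF _ xX) (sP x) wx _.
    by rewrite -vE.
  rewrite inE => /andP[xX /subsetP xY] ->; split; first exact/xY/sP.
  exact: imset_f.
have [|y1 [y1E y1X]] := @two_factor_system _ F X F2 XT (fun v => v \notin S) (fun=> false).
  move=> Y cl; apply/negP; rewrite (_ : [set v in Y | v \notin S] = Y :\: S) ?evenS //.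
  by apply/setP => v; rewrite !inE andbC.
(* At a marked vertex [M2] has even degree, and not 2 as it avoids [X]. *)
pose M2 := y1 :&: F.
have dM : [disjoint M & M2].
  by apply/pred0P => e /=; rewrite !inE; case: (e \in M); rewrite ?andbF.
have M2deg v : degree M2 v = (v \notin S).
  have le2 : (degree M2 v <= 2)%N.
    rewrite -(eqP (forallP F2 v)); apply/subset_leq_card/subsetP => e.
    by rewrite !inE => /andP[/andP[_ ->] ->].
  have := y1E v; rewrite -/M2; have [vS|vS] := boolP (v \in S); last first.
    by case: (degree M2 v) le2 => [|[|[|]]].
  suff : (degree M2 v < 2)%N by case: (degree M2 v) => [|[|]].
  rewrite -(eqP (forallP F2 v)); apply: proper_card; apply/properP; split.
    by apply/subsetP => e; rewrite !inE => /andP[/andP[_ ->] ->].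
  have /imsetP[x xX vx] := vS.
  by exists x; rewrite !inE ?y1X //= vx sP andbT -in_setC (subsetP XF).
(* [p] gives the direction of the flow on [M :|: M2]: the half-edge of [M] at
   [v] has sign [(-1) ^+ (v \in p)], that of [M2] the opposite sign. *)
have [||p pP] := @two_matchings_bipartite G M M2 dM.
  by move=> v; rewrite (eqP (forallP M1 v)).
  by move=> v; rewrite M2deg; case: (_ \notin S).
(* [y] holds the signs of the unit flow on [F].  At unmarked vertices the two
   half-edges of [F] get opposite signs, at marked ones both are opposite to
   the half-edge of [M]. *)
pose Tv v : {set edge G} := [set e | T e v].
pose b v := (v \notin S) (+) odd (degree (Tv v :&: F) v).
have [|y [yE yX]] := @two_factor_system _ F X F2 XT b (fun x => ~~ (s x \in p) (+) T x (s x)).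
  move=> Y cl; rewrite card_sum_nat.
  have -> : odd (\sum_(v in Y) b v) =
      odd (\sum_(v in Y) ((v \notin S) + degree (Tv v :&: F) v)%N).
    rewrite !(big_morph odd oddD (erefl : odd 0 = false)).
    by apply: eq_bigr => v _; rewrite oddD !oddb.
  rewrite big_split /= oddD -card_sum_nat.
  have -> : [set v in Y | v \notin S] = Y :\: S by apply/setP => v; rewrite !inE andbC.
  rewrite evenS //=.
  have -> : \sum_(v in Y) degree (Tv v :&: F) v = #|[set e in F :\: X | s e \in Y]|.
    rewrite card_sum_nat (eq_bigr (fun v => \sum_(e in F :\: X) (v == s e : nat))).
      rewrite exchange_big /=; apply: eq_bigr => e _.
      have [sY|sY] := boolP (s e \in Y).
        rewrite (bigD1 (s e)) //= eqxx big1 // => v /andP[_ /negPf ->] //.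
      by rewrite big1 // => v vY; case: eqP => // E; rewrite -E vY in sY.
    move=> v _; rewrite -card_sum_nat; congr #|pred_of_set _|; apply/setP => e.
    rewrite !inE /T; have [->|] := eqVneq v (s e); last by rewrite !andbF.
    by rewrite sP !andbT.
  have -> : [set e in F :\: X | s e \in Y] = inner_edges F Y :\: inner_edges X Y.
    apply/setP => e; rewrite !inE; have [eM|eM] /= := boolP (e \in M).
      by rewrite !andbF.
    have [eX|eX] //= := boolP (e \in X); first by case: (_ \subset _).
    apply/idP/subsetP => [sY u ue|]; last by apply; apply: sP.
    by move/edge_closedP: cl => cl; apply: cl _ (sP e) ue sY; rewrite inE.
  rewrite cardsD (setIidPr _); last first.
    by apply/subsetP => e; rewrite !inE => /andP[/(subsetP XF)]; rewrite inE => -> ->.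
  have := transversal_inner F2 XT cl; rewrite (card_inner_2factor F2 cl) => E.
  rewrite oddB ?E ?addbb //; rewrite -(card_inner_2factor F2 cl) subset_leq_card //.
  by apply/subsetP => e; rewrite !inE => /andP[/(subsetP XF)]; rewrite inE => -> ->.
pose sg (c : bool) : R := (-1) ^+ c.
have sgE c : sg c = 1 \/ sg c = -1 by case: c; rewrite /sg ?expr1 ?expr0; [right | left].
(* [2 * sg (s e \in p)] occurs with sign minus on [M], as [T e (s e)] is true there. *)
pose f e : R := (e \in F)%:R * sg (e \in y) + 2 * ((e \in M2)%:R - (e \in M)%:R) * sg (s e \in p).
have fM e : e \in M -> f e = - 2 * sg (s e \in p).
  by move=> eM; rewrite /f (disjointFr dM eM) inE eM /= mul0r add0r sub0r mulrN1.
have fM2 e : e \in M2 -> f e = sg (e \in y) + 2 * sg (s e \in p).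
  by move=> eM; rewrite /f (disjointFl dM eM) eM; move: eM; rewrite inE => /andP[_ ->];
    rewrite subr0 mul1r mulr1.
have fF e : e \in F -> e \notin M2 -> f e = sg (e \in y).
  by move=> eF eM2; rewrite /f eF (negPf eM2); move: eF; rewrite inE => /negPf ->;
    rewrite subrr mulr0 mul0r addr0 mul1r.
exists T, f; split; last first.
  move=> e; rewrite /f; have sgi c : sg c \is a Num.int by rewrite /sg rpredX ?rpredN1.
  by rewrite rpredD ?rpredM ?rpredB ?rpred_nat.
split=> //.
  move=> e; have [eM|eM] := boolP (e \in M).
    rewrite fM //; case: (sgE (s e \in p)) => ->; rewrite ?mulr1 ?mulrN1 ?opprK ?normrN ger0_norm //; lra.
  have eF : e \in F by rewrite inE.
  have [eM2|eM2] := boolP (e \in M2).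
    rewrite fM2 //; case: (sgE (s e \in p)) => ->; case: (sgE (e \in y)) => ->;
    rewrite ?mulr1 ?mulrN1; [rewrite ger0_norm|rewrite ger0_norm|rewrite ler0_norm|rewrite ler0_norm]; lra.
  rewrite fF //; case: (sgE (e \in y)) => ->; rewrite ?normrN normr1; lra.
have TsgE e v : e \in M :|: M2 -> v \in ends e -> sg (T e v) * sg (s e \in p) = - sg (v \in p).
  move=> eMM ve; have eX : e \notin X.
    move: eMM; rewrite inE => /orP[eM|eM2]; apply/negP => eX.
      by have := subsetP XF e eX; rewrite inE eM.
    by move: eM2; rewrite inE (y1X e eX).
  rewrite /T eX /=; have [->|vs] := eqVneq v (s e); first by rewrite /sg expr1 mulN1r.
  have [u us eE] := end_other (sP e).
  have vu : v = u by move: ve; rewrite eE !inE (negPf vs) => /eqP.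
  have := subsetP pP e eMM; rewrite (in_cut p _ eE) 1?eq_sym // vu /sg mul1r.
  by case: (s e \in p); case: (u \in p) => //= _; rewrite ?expr1 ?expr0 ?opprK.
have hvM e v : e \in M -> v \in ends e -> half_edge_value T f e v = 2 * sg (v \in p).
  move=> eM ve; have := TsgE e v; rewrite inE eM => /(_ isT ve) E.
  rewrite /half_edge_value fM // -/(sg (T e v)).
  rewrite mulrCA E; lra.
have hvF e v : e \in F -> half_edge_value T f e v =
    sg (T e v (+) (e \in y)) + (e \in M2)%:R * (2 * (sg (T e v) * sg (s e \in p))).
  move=> eF; rewrite /half_edge_value -/(sg (T e v)).
  have sgD c d : sg (c (+) d) = sg c * sg d by rewrite /sg signr_addb.
  rewrite sgD; have [eM2|eM2] := boolP (e \in M2); last by rewrite fF // mul0r addr0.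
  by rewrite fM2 // mulrDr mul1r; congr (_ + _); rewrite mulrCA.
move=> v; have /forallP/(_ v)/cards1P[e0 ME] := M1.
have : e0 \in [set e in M | v \in ends e] by rewrite ME set11.
rewrite inE => /andP[e0M ve0]; have [e1 [e2 [e10 e20 e12 E]]] := cubic_star G_cubic ve0.
have inv x : (v \in ends x) = (x \in [set e0; e1; e2]) by rewrite -E inE.
have ve1 : v \in ends e1 by rewrite inv !inE eqxx orbT.
have ve2 : v \in ends e2 by rewrite inv !inE eqxx orbT.
have inF x : v \in ends x -> x != e0 -> x \in F.
  move=> vx xe0; rewrite inE; apply: contra xe0 => xM.
  have : x \in [set e in M | v \in ends e] by rewrite inE xM.
  by rewrite ME inE.
have e1F := inF e1 ve1 e10; have e2F := inF e2 ve2 e20.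
have degD D : odd (degree (D :&: F) v) = (e1 \in D) (+) (e2 \in D).
  rewrite -(odd_card_cap_pair D e12); congr (odd #|pred_of_set _|).
  apply/setP => x; rewrite [LHS]inE [RHS]inE in_setI inv !inE.
  have [->|xe0] := eqVneq x e0.
    by rewrite e0M andbF /= ![e0 == _]eq_sym (negPf e10) (negPf e20) andbF.
  have [x12|] /= := boolP ((x == e1) || (x == e2)); last by rewrite !andbF.
  have vx : v \in ends x by rewrite inv !inE -orbA x12 orbT.
  by have := inF x vx xe0; rewrite inE => ->; rewrite !andbT.
rewrite (sum_star _ e10 e20 e12 E) hvM // !hvF //.
have yv := yE v; rewrite /b !degD !inE in yv.
have M2v := congr1 odd (M2deg v); rewrite oddb degD in M2v.
have M2I e : e \in F -> (e \in M2) = (e \in y1) by move=> eF; rewrite in_setI eF andbT.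
rewrite !M2I //.
have sgN c : sg (~~ c) = - sg c by rewrite /sg signrN.
have Tv12 e : v \in ends e -> e \in F -> e \in y1 -> sg (T e v) * sg (s e \in p) = - sg (v \in p).
  by move=> ve eF ey; apply: TsgE => //; rewrite inE M2I // ey orbT.
have [vS|vS] := boolP (v \in S).
  have /imsetP[x xX vx] := vS.
  have vxe : v \in ends x by rewrite vx sP.
  have xy := yX x xX; rewrite -vx in xy; have xy1 := y1X x xX.
  have xF : x \in F := subsetP XF x xX.
  have : x \in [set e0; e1; e2] by rewrite -inv.
  rewrite vS /= in yv M2v; rewrite !inE -orbA => /or3P[/eqP xE|/eqP xE|/eqP xE].
  - by move: xF; rewrite xE inE e0M.
  - move: M2v yv; rewrite -xE xy1 xy /= => -> yv; rewrite !mul0r !addr0.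
    have -> : T e2 v (+) (e2 \in y) = ~~ (v \in p).
      by move: yv; case: (T x v); case: (T e2 v); case: (e2 \in y); case: (v \in p).
    have -> : T x v (+) (~~ (v \in p) (+) T x v) = ~~ (v \in p) by case: (T x v); case: (v \in p).
    rewrite !sgN; lra.
  move: M2v yv; rewrite -xE xy1 xy addbF /= => -> yv; rewrite !mul0r !addr0.
  have -> : T e1 v (+) (e1 \in y) = ~~ (v \in p).
    by move: yv; case: (T x v); case: (T e1 v); case: (e1 \in y); case: (v \in p).
  have -> : T x v (+) (~~ (v \in p) (+) T x v) = ~~ (v \in p) by case: (T x v); case: (v \in p).
  rewrite !sgN; lra.
have -> : T e2 v (+) (e2 \in y) = ~~ (T e1 v (+) (e1 \in y)).
  by move: yv; rewrite vS /=; case: (T e1 v); case: (T e2 v); case: (e1 \in y); case: (e2 \in y).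
rewrite sgN; move: M2v; rewrite vS; have [e1y|e1y] := boolP (e1 \in y1).
  by move=> /= /negbTE ->; rewrite (Tv12 e1) // mul0r mul1r; lra.
move=> /= e2y; rewrite e2y (Tv12 e2) // mul0r mul1r; lra.
Qed.

End FourFlows.

(** * Every edge of a bridgeless cubic graph lies in a 1-factor *)

Section Schonberger.
Local Open Scope nat_scope.
Variable G : multigraph.
Hypotheses (G_cubic : cubic G).
Implicit Types (d e : edge G) (u v : vertex G).

Lemma bridgeless_cut : bridgeless G -> forall A : {set vertex G}, #|cut A| != 1.
Proof.
move=> nbr A; apply/negP => /cards1P[e cutE]; case/negP: (nbr e).
have cl : edge_closed [set~ e] A by apply/pred0P => d /=; rewrite cutE !inE andNb.
have [u [v [uv eE]]] := endsP e.
have : e \in cut A by rewrite cutE set11.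
rewrite (in_cut _ uv eE) => uvA.
have [x [y [xe ye xA yA]]] : exists x y, [/\ x \in ends e, y \in ends e, x \in A & y \notin A].
  have [uA|uA] := boolP (u \in A); [exists u, v | exists v, u]; rewrite eE !inE !eqxx ?orbT;
  by split=> //; move: uvA; rewrite ?uA ?(negPf uA); case: (v \in A).
apply/existsP; exists x; rewrite xe; apply/existsP; exists y; rewrite ye.
by apply: contra yA => con; apply: edge_closed_connect cl con xA.
Qed.

Lemma cubic_sum (A : {set vertex G}) : \sum_(v in A) degree [set: edge G] v = 3 * #|A|.
Proof. by under eq_bigr => v _ do rewrite G_cubic; rewrite sum_nat_const mulnC. Qed.

Lemma cubic_odd_cut (A : {set vertex G}) : odd #|cut A| = odd #|A|.
Proof. by have := odd_cut_sum [set: edge G] A; rewrite cubic_sum setTI oddM. Qed.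

Lemma cubic_even : ~~ odd #|vertex G|.
Proof.
rewrite -cardsT -cubic_odd_cut; have -> : cut [set: vertex G] = set0; last by rewrite cards0.
by apply/setP => e; have [u [v [uv eE]]] := endsP e; rewrite (in_cut _ uv eE) !inE.
Qed.

Section ThroughEdge.
Variable e : edge G.

Let T : finType := {x : vertex G | x \notin ends e}.
Let adj : rel T := fun x y => adjacent [set: edge G] (val x) (val y).

Let adj_sym : symmetric adj. Proof. by move=> x y; apply: adjacent_sym. Qed.
Let adj_irr : irreflexive adj. Proof. by move=> x; rewrite /adj /adjacent eqxx. Qed.

(** Since [p] depends only on the unordered pair of matched vertices, parallel
    edges cause no ambiguity. *)
Let matching_factor (m : T -> T) : perfect_matching adj m ->
  exists2 M, factor 1 M & e \in M.
Proof.
move=> pm; pose p x := odflt e [pick d | ends d == [set val x; val (m x)]].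
have pE x : ends (p x) = [set val x; val (m x)].
  rewrite /p; case: pickP => [d /eqP //|none].
  by have [_ /adjacentP[_ [d _ dE]]] := pm x; move: (none d); rewrite dE eqxx.
have pm_m x : p (m x) = p x.
  by rewrite /p; have [-> _] := pm x; rewrite setUC.
exists (e |: p @: T); last by rewrite !inE eqxx.
apply/forallP => v; apply/cards1P; have [ve|ve] := boolP (v \in ends e).
  exists e; apply/setP => d; rewrite !inE; apply/andP/eqP => [[/orP[/eqP//|]]|->]; last by rewrite eqxx.
  case/imsetP=> x _ ->; rewrite pE !inE => /orP[] /eqP E; move: ve; rewrite E.
    by rewrite (negPf (valP x)).
  by rewrite (negPf (valP (m x))).
pose x : T := Sub v ve; exists (p x); apply/setP => d; rewrite !inE; apply/andP/eqP.
  case=> /orP[/eqP ->|/imsetP[z _ ->]]; first by rewrite (negPf ve).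
  rewrite pE !inE => /orP[] /eqP E.
    by congr p; apply: val_inj; rewrite /= -E.
  by rewrite -pm_m; congr p; apply: val_inj; rewrite /= -E.
by move=> ->; rewrite imset_f ?orbT //; rewrite pE !inE eqxx.
Qed.

(** An odd label class [K l] has an odd boundary, hence at least 3 edges, all
    ending in [S]; but [S] has [#|U| + 2] vertices and sends out at most [3 * #|S| - 2]
    edges, as [e] lies inside.  So there are fewer than [#|S|] odd classes, and
    by parity at most [#|U|]. *)
Let barrier_absurd (U : {set T}) (c : T -> T) :
  (forall A : {set vertex G}, #|cut A| != 1) -> barrier adj U c -> False.
Proof.
move=> cut1 [cE ltU]; set L := odd_labels U c in ltU.
pose K l : {set vertex G} := [set val x | x in label_class U c l].
pose S := ends e :|: [set val x | x in U].
have cardK l : #|K l| = #|label_class U c l| by apply/card_imset/val_inj.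
have KP l v : v \in K l -> exists x : T, [/\ v = val x, x \notin U & c x = l].
  by case/imsetP=> x; rewrite inE => /andP[xU /eqP cx] ->; exists x.
have notS v : v \notin S -> exists2 x : T, v = val x & x \notin U.
  rewrite inE negb_or => /andP[ve vU]; exists (Sub v ve : T) => //.
  by apply: contra vU => H; apply/imsetP; exists (Sub v ve : T).
have KS l v : v \in K l -> v \notin S.
  case/KP=> x [-> xU _]; rewrite inE negb_or (valP x) /=.
  by apply/imsetP => -[y yU /val_inj E]; rewrite E yU in xU.
have cutK l d : d \in cut (K l) -> exists x : T, exists v,
    [/\ val x != v, ends d = [set val x; v], x \notin U, c x = l & v \in S].
  have [a [b [ab dE]]] := endsP d; rewrite (in_cut _ ab dE) => abK.
  have {abK ab dE}[a' [b' [ab dE aK bK]]] : exists a b, [/\ a != b, ends d = [set a; b],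
      a \in K l & b \notin K l].
    have [aK|aK] := boolP (a \in K l).
      by exists a, b; split=> //; move: abK; rewrite aK.
    exists b, a; split=> //; [by rewrite eq_sym | by rewrite setUC | by move: abK; rewrite (negPf aK)].
  have [x [ax xU cx]] := KP l a' aK; exists x, b'; rewrite -ax; split=> //.
  apply/negPn/negP => /notS[y by_ yU]; case/negP: bK; rewrite by_.
  apply: imset_f; rewrite inE yU -cx; apply/eqP/esym/cE => //.
  by apply/adjacentP; rewrite -ax -by_; split=> //; exists d.
have cutKS l d : d \in cut (K l) -> d \in cut S.
  case/cutK=> x [v [xv dE xU cx vS]]; rewrite (in_cut _ xv dE) vS.
  by rewrite (negPf (KS l (val x) _)) // imset_f // inE xU cx eqxx.
have cut_uniq l l' d : d \in cut (K l) -> d \in cut (K l') -> l = l'.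
  case/cutK=> x [v [xv dE xU cx vS]] /cutK[x' [v' [xv' dE' xU' cx' vS']]].
  have : val x \in [set val x'; v'] by rewrite -dE' dE !inE eqxx.
  rewrite !inE => /orP[/eqP/val_inj xx'|/eqP xv2]; first by rewrite -cx -cx' xx'.
  have : val x \in K l by rewrite imset_f // inE xU cx eqxx.
  by move/KS; rewrite xv2 vS'.
have sumL : 3 * #|L| <= #|cut S|.
  apply: (@leq_trans (\sum_(l in L) #|cut (K l)|)).
    rewrite mulnC -sum_nat_const; apply: leq_sum => l; rewrite inE => oddl.
    have : odd #|cut (K l)| by rewrite cubic_odd_cut cardK.
    by have := cut1 (K l); case: #|cut _| => [|[|[|]]].
  have -> : \sum_(l in L) #|cut (K l)| = \sum_(l in L) \sum_(d in cut S) (d \in cut (K l)).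
    apply: eq_bigr => l _; rewrite -card_sum_nat; congr #|pred_of_set _|.
    apply/setP => d; rewrite [RHS]inE; apply/idP/andP => [dK|[]//].
    by split=> //; apply: cutKS dK.
  rewrite exchange_big -sum1_card; apply: leq_sum => d dS.
  rewrite -card_sum_nat; apply/card_le1_eqP => l l'; rewrite !inE => /andP[_ dl] /andP[_ dl'].
  by apply: (cut_uniq l' l d); rewrite inE.
have cardS : #|S| = #|U|.+2.
  rewrite cardsU card_ends card_imset; last exact: val_inj.
  rewrite (_ : _ :&: _ = set0) ?cards0 ?subn0 //.
  apply/setP => v; rewrite !inE; apply/andP => -[ve /imsetP[x _ vx]].
  by move: (valP x); rewrite -vx ve.
(* The summand of [e] is 2 although [e] is not in the cut. *)
have cutS : #|cut S| + 2 <= 3 * #|S|.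
  have := degree_sum [set: edge G] S; rewrite cubic_sum => ->.
  rewrite (bigD1 e) ?inE //= (setIidPl _) ?subsetUl // card_ends addnC leq_add2l.
  rewrite -sum1_card big_mkcond [X in _ <= X]big_mkcond /=; apply: leq_sum => d _.
  rewrite !inE /=; have [->|de] := eqVneq d e.
    by rewrite (setIidPl _) ?subsetUl // card_ends.
  by case: ifP => // /eqP ->.
have parL : odd #|L| = odd #|U|.
  have cardT : #|T| + 2 = #|vertex G|.
    by rewrite card_sig -(card_ends e) -(cardC (mem (ends e))) addnC; congr (_ + _).
  have := cubic_even; rewrite -cardT oddD addbF -(cardsC U) oddD => evT.
  suff -> : odd #|L| = odd #|~: U| by case: (odd _) evT; case: (odd _).
  rewrite odd_card_bigaddb -sum1_card [in RHS](partition_big c xpredT) //=.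
  rewrite [in RHS](big_morph odd oddD (erefl : odd 0 = false)).
  apply: eq_bigr => l _; rewrite inE -sum1_card; congr (odd _).
  by apply: eq_bigl => x; rewrite !inE.
move: sumL cutS ltU parL; rewrite cardS; lia.
Qed.

(** Schonberger's theorem: delete the ends of [e] and match the rest. *)
Lemma edge_in_factor : (forall A : {set vertex G}, #|cut A| != 1) ->
  exists2 M, factor 1 M & e \in M.
Proof.
move=> cut1; have [[m /matching_factor//]|[U [c]]] := tutte adj_sym adj_irr.
by move/(barrier_absurd cut1).
Qed.

End ThroughEdge.
End Schonberger.

(** * Transversals, oddness and single-edge cuts *)

Section Transversals.
Local Open Scope nat_scope.
Variables (G : multigraph) (e0 : edge G).
Hypothesis G_cubic : cubic G.
Implicit Types (d e x : edge G) (u v : vertex G) (F M X Z : {set edge G}).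

Lemma factor2_compl F : factor 2 F -> factor 1 (~: F).
Proof.
move=> F2; apply/forallP => v; have := G_cubic v; have := forallP F2 v; rewrite /degree => /eqP F2v.
rewrite -(cardsID F) (_ : _ :&: F = [set e in F | v \in ends e]); last first.
  by apply/setP => e; rewrite !inE andbC.
rewrite F2v !addSn add0n (_ : _ :\: F = [set e in ~: F | v \in ends e]) => [[->]//|].
by apply/setP => e; rewrite !inE.
Qed.

Lemma circuit_choice F Z : (forall C, C \in odd_circuits F -> C :&: Z != set0) ->
  exists q : {set edge G} -> edge G, forall C, C \in odd_circuits F -> q C \in C :&: Z.
Proof.
move=> CZ; exists (fun C => odflt e0 [pick x in C :&: Z]) => C /CZ.
by case: pickP => // none /set0Pn[x]; rewrite none.
Qed.

Lemma transversal_in F Z : factor 2 F ->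
  (forall C, C \in odd_circuits F -> C :&: Z != set0) ->
  exists X, [/\ odd_transversal F X, X \subset Z & #|X| = #|odd_circuits F|].
Proof.
move=> F2 /circuit_choice[q qP].
have qC C : C \in odd_circuits F -> q C \in C by move/qP; rewrite inE => /andP[].
have [XT cX] := choice_transversal F2 qC.
exists (q @: odd_circuits F); split=> //.
by apply/subsetP => _ /imsetP[C /qP CZ ->]; move: CZ; rewrite inE => /andP[].
Qed.

(** Choosing an edge of [X] in every odd circuit exhausts [X]. *)
Lemma transversal_card F X : factor 2 F -> odd_transversal F X ->
  #|X| = #|odd_circuits F|.
Proof.
move=> F2 XT; have [XF XC] := XT.
have OX C : C \in odd_circuits F -> C :&: X != set0.
  by case/odd_circuitsP=> CF cC oddC; rewrite setIC -cards_eq0 XC // oddC.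
have [X' [[_ X'C] X'X <-]] := transversal_in F2 OX.
congr #|pred_of_set _|; apply/eqP; rewrite eq_sym eqEsubset X'X /=.
apply/subsetP => x xX; have [C [CF cC E]] := transversal_circuit F2 XT xX.
have := X'C C CF cC; rewrite -XC // E cards1 => /eqP/cards1P[x' x'E].
have : x' \in X' :&: C by rewrite x'E set11.
rewrite inE => /andP[x'X' x'C].
have : x' \in X :&: C by rewrite inE (subsetP X'X).
by rewrite E inE => /eqP <-.
Qed.

Lemma odd_circuits_le F Z : factor 2 F ->
  (forall C, C \in odd_circuits F -> C :&: Z != set0) -> #|odd_circuits F| <= #|Z|.
Proof. by move=> F2 /(transversal_in F2)[X [_ XZ <-]]; apply: subset_leq_card. Qed.

Lemma odd_circuit_neq0 F C : C \in odd_circuits F -> C != set0.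
Proof. by case/odd_circuitsP=> _ /and3P[]. Qed.

Lemma odd_circuit_meetsT F C : C \in odd_circuits F -> C :&: setT != set0.
Proof. by move/odd_circuit_neq0; rewrite setIT. Qed.

Lemma oddness_le F : factor 2 F -> oddness G <= #|odd_circuits F|.
Proof. by move=> F2; have := @bigmin_le_cond _ _ _ #|edge G| F (factor 2) (fun F : {set edge G} => #|odd_circuits F|) F2. Qed.

Lemma oddness_attained F : factor 2 F ->
  exists2 F' : {set edge G}, factor 2 F' & #|odd_circuits F'| = oddness G.
Proof.
move=> F2; rewrite /oddness (bigmin_eq_arg _ F _ _ F2) => [|F' F'2].
  by case: arg_minP => // F' F'2 _; exists F'.
rewrite leEnat -cardsT; apply: odd_circuits_le => // C.
exact: odd_circuit_meetsT.
Qed.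

(** A circuit crosses a cut evenly, so an odd one is not contained in it. *)
Lemma antibalanced_meets F X C : antibalanced X -> C \in odd_circuits F ->
  C :&: X != set0.
Proof.
move=> [A ->] /odd_circuitsP[_ /and3P[_ /forallP degC _] oddC].
apply: contraL oddC => /eqP CA; have -> : C = C :&: cut A.
  by apply/esym/setIidPl; rewrite -[cut A]setCK -disjoints_subset -setI_eq0 CA.
rewrite -odd_cut_sum (big_morph odd oddD (erefl : odd 0 = false)) big1 // => v _.
by case/orP: (degC v) => /eqP ->.
Qed.

Section PendantCuts.
Variable M : {set edge G}.
Hypothesis M1 : factor 1 M.
Let F := ~: M.
Let F2 : factor 2 F := factor_compl G_cubic M1.
Hypothesis allanti : forall X, odd_transversal F X -> antibalanced X.

(** Let [e] and [e'] be the edges of [C] at [v].  Two transversals that differ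
    by [e] and [e'] only are complements of cuts, so [e] and [e'] form a cut;
    adding the cut around [v] leaves [m]. *)
Lemma pendant_cut C x v m : C \in odd_circuits F -> x \in C -> v \in ends x ->
  m \in M -> v \in ends m -> exists A, cut A = [set m].
Proof.
move=> CO xC vx mM vm; have [CF cC oddC] := odd_circuitsP CO.
have [e [e' [em e'm ee' star]]] := cubic_star G_cubic vm.
have inv y : (v \in ends y) = (y \in [set m; e; e']) by rewrite -star inE.
have ve : v \in ends e by rewrite inv !inE eqxx orbT.
have ve' : v \in ends e' by rewrite inv !inE eqxx orbT.
have notM y : v \in ends y -> y != m -> y \in F.
  move=> vy ym; have /forallP/(_ v)/cards1P[z zE] := M1.
  rewrite inE; apply: contra ym => yM.
  have : y \in [set z] by rewrite -zE inE yM.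
  have : m \in [set z] by rewrite -zE inE mM.
  by rewrite !inE => /eqP -> ->.
have eC : e \in C := circuit_edges_at F2 CF cC xC vx (notM e ve em) ve.
have e'C : e' \in C := circuit_edges_at F2 CF cC xC vx (notM e' ve' e'm) ve'.
have [q qP'] := @circuit_choice F setT (fun C' => @odd_circuit_meetsT F C').
have qP C' : C' \in odd_circuits F -> q C' \in C'.
  by move/qP'; rewrite setIT.
pose Y := q @: (odd_circuits F :\ C).
have trans y : y \in C -> odd_transversal F (y |: Y).
  move=> yC; pose qy C' := if C' == C then y else q C'.
  have qyP C' : C' \in odd_circuits F -> qy C' \in C'.
    by move=> C'O; rewrite /qy; case: eqP => [->//|_]; apply: qP.
  have [+ _] := choice_transversal F2 qyP.
  rewrite -(setD1K CO) imsetU1 {1}/qy eqxx (_ : qy @: _ = Y) //.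
  by apply: eq_in_imset => C'; rewrite !inE /qy => /andP[/negPf ->].
have notY y : y \in C -> y \notin Y.
  move=> yC; apply/imsetP => -[C' /setD1P[C'C C'O] yE]; case/eqP: C'C.
  have [C'F cC' _] := odd_circuitsP C'O.
  by apply: (circuit_eq F2 C'F cC' CF cC _ yC); rewrite yE qP.
have [A1 A1E] := allanti (trans e eC); have [A2 A2E] := allanti (trans e' e'C).
exists (symdiff (symdiff A1 A2) [set v]); apply/setP => d.
have A1d := congr1 (fun D : {set edge G} => d \in D) A1E.
have A2d := congr1 (fun D : {set edge G} => d \in D) A2E.
rewrite in_setU1 in_setC in A1d; rewrite in_setU1 in_setC in A2d.
rewrite !cut_symdiff cut1 [in X in _ (+) X]inE inv -[d \in cut A1]negbK -A1d.
rewrite -[d \in cut A2]negbK -A2d !inE.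
have [->|de] := eqVneq d e; first by rewrite (negPf (notY e eC)) (negPf em) (negPf ee').
have [->|de'] := eqVneq d e'; first by rewrite (negPf (notY e' e'C)) (negPf e'm).
by case: (d \in Y); case: (d == m).
Qed.

(** A minimal set [A] bounded by a single edge [b] has odd size and is closed
    under [F], so it contains an odd circuit.  The edge of [M] at a vertex of
    that circuit away from [b] bounds a set [B]; intersecting [A] with the side
    of [B] away from [b] contradicts minimality. *)
Lemma no_odd_circuit : odd_circuits F = set0.
Proof.
apply/eqP/set0Pn => -[C CO].
have [x xC] := odd_circuit_edges CO; have [v [u [_ xE]]] := endsP x.
have vx : v \in ends x by rewrite xE !inE eqxx.
have atM w : exists2 m, m \in M & w \in ends m.
  have /forallP/(_ w)/cards1P[m mE] := M1; exists m;
  by have := set11 m; rewrite -mE inE => /andP[].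
have [m mM vm] := atM v; have [A0 A0E] := pendant_cut CO xC vx mM vm.
have cutA0 : #|cut A0| == 1 by rewrite A0E cards1.
(* Inclusion-minimal is enough, as only a subset of [A] is produced below. *)
have [A /minsetP[/cards1P[b bE] Amin] _] :=
  @minset_exists _ (fun A => #|cut A| == 1) A0 cutA0.
have bcut : b \in cut A by rewrite bE set11.
have bM : b \in M.
  apply/negPn/negP => bM; have := odd_cut_sum F A.
  have -> : F :&: cut A = [set b] by rewrite bE; apply/setIidPr; rewrite sub1set inE.
  rewrite cards1 (big_morph odd oddD (erefl : odd 0 = false)) big1 // => w _.
  by rewrite (eqP (forallP F2 w)).
have cl : edge_closed F A.
  by apply/pred0P => d /=; rewrite bE !inE; have [->|] := eqVneq d b; rewrite ?bM ?andbF.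
have [X0 [X0T _ _]] := @transversal_in F setT F2 (fun C' => @odd_circuit_meetsT F C').
have : odd #|inner_edges X0 A| by rewrite (transversal_inner F2 X0T cl) -(cubic_odd_cut G_cubic) bE cards1.
have [->|[y]] := set_0Vmem (inner_edges X0 A); first by rewrite cards0.
rewrite inE => /andP[yX /subsetP yA] _.
have [D [DF cD XD]] := transversal_circuit F2 X0T yX.
have DO : D \in odd_circuits F.
  by apply/odd_circuitsP; split=> //; have := X0T.2 D DF cD; rewrite XD cards1; case: (odd _).
have yD : y \in D by have := set11 y; rewrite -XD inE => /andP[].
have [a [a' [aa' bab aA a'A]]] : exists a a', [/\ a != a', ends b = [set a; a'], a \in A & a' \notin A].
  have [a [a' [aa' bab]]] := endsP b; move: bcut; rewrite (in_cut _ aa' bab) => H.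
  have [aA|aA] := boolP (a \in A); first by exists a, a'; split=> //; move: H; rewrite aA.
  exists a', a; split=> //; rewrite 1?eq_sym 1?setUC //.
  by move: H; rewrite (negPf aA).
have [w wy wa] : exists2 w, w \in ends y & w != a.
  have [w [w' [ww' yE]]] := endsP y; have [E|wa] := eqVneq w a.
    by exists w'; rewrite ?yE ?inE ?eqxx ?orbT // -E eq_sym.
  by exists w; rewrite // yE !inE eqxx.
have wA := yA w wy; have [n nM wn] := atM w.
have nb : n != b.
  apply: contraTneq wn => ->; rewrite bab !inE (negPf wa) /=.
  by apply: contraNneq a'A => <-.
have [B0 B0E] := pendant_cut DO yD wy nM wn.
have [B BE aB] : exists2 B, cut B = [set n] & a \notin B.
  have [aB|aB] := boolP (a \in B0); last by exists B0.
  by exists (~: B0); rewrite ?cutC // inE aB.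
have cutBA : cut (B :&: A) = [set n].
  apply/setP => d; have [s [t [st dE]]] := endsP d; rewrite (in_cut _ st dE) !inE.
  have := congr1 (fun D : {set edge G} => d \in D) BE; rewrite /= (in_cut _ st dE) inE => dB.
  have := congr1 (fun D : {set edge G} => d \in D) bE; rewrite /= (in_cut _ st dE) inE => dA.
  have [dn|dn] := eqVneq d n.
    have wst : w \in [set s; t] by rewrite -dE dn.
    move: dA dB; rewrite dn (negPf nb) eqxx => dA; suff [-> ->] : s \in A /\ t \in A by rewrite !andbT.
    by move: wst dA; rewrite !inE => /orP[] /eqP <-; rewrite wA; case: (_ \in A).
  rewrite (negPf dn) in dB; have [db|db] := eqVneq d b; last first.
    by rewrite (negPf db) in dA; move: dA dB; do 4 case: (_ \in _).
  have : a \in [set s; t] by rewrite -dE db bab !inE eqxx.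
  have sB : (s \in B) = (t \in B) by move: dB; do 2 case: (_ \in B).
  by rewrite !inE sB => /orP[] /eqP E; move: aB; rewrite E ?sB => /negPf ->.
have := Amin (B :&: A); rewrite cutBA cards1 eqxx => /(_ isT (subsetIr _ _)) E.
by move: aA; rewrite -E inE (negPf aB).
Qed.

End PendantCuts.
End Transversals.

(** * Flow numbers 3 and 4 *)

Section FlowNumbers.
Variables (R : realType) (G : multigraph) (e0 : edge G) (M : {set edge G}).
Hypotheses (G_cubic : cubic G) (M1 : factor 1 M).
Implicit Types (sigma : signature G) (X : {set edge G}).

Lemma negative_edgesK X : negative_edges (signature_of X) = X.
Proof. by apply/setP => e; rewrite inE ffunE. Qed.

Lemma signature_ofK sigma : signature_of (negative_edges sigma) = sigma.
Proof. by apply/ffunP => e; rewrite ffunE inE. Qed.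

Lemma circular_flow_number_ge (a : R) sigma :
  (forall r, admits_nz_flow sigma r -> a <= r) ->
  (a%:E <= circular_flow_number R sigma)%E.
Proof. by move=> H; apply: le_ereal_inf_tmp => _ [r /= /H ar <-]; rewrite lee_fin. Qed.

Lemma circular_flow_number_le (a : R) sigma :
  admits_nz_flow sigma a -> (circular_flow_number R sigma <= a%:E)%E.
Proof. by move=> H; apply: ereal_inf_lbound; exists a. Qed.

(** The value 3 need not be attained a priori, but an infimum below 4 already
    yields a flow below 4. *)
Lemma circular_flow_number_eq3 sigma :
  circular_flow_number R sigma = 3%:E <-> antibalanced (negative_edges sigma).
Proof.
split=> [E|anti]; last first.
  apply/eqP; rewrite eq_le circular_flow_number_ge => [|r].
    by rewrite andbT; apply: circular_flow_number_le; apply: antibalanced_flow3 M1 anti.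
  by move/admits_pair_flow=> [T [f fP]]; apply: (pair_flow_ge3 G_cubic e0 fP).
have : (circular_flow_number R sigma < 4%:E)%E by rewrite E lte_fin; lra.
case/ereal_inf_lt=> _ [r /= rP <-]; rewrite lte_fin => r4.
have [T [f fP]] := admits_pair_flow rP.
exact: pair_flow_lt4 fP r4.
Qed.

Lemma circular_flow_number_eq4 sigma : ~ antibalanced (negative_edges sigma) ->
  admits_nz_flow sigma (4 : R) -> circular_flow_number R sigma = 4%:E.
Proof.
move=> nanti f4; apply/eqP; rewrite eq_le circular_flow_number_le //=.
apply: circular_flow_number_ge => r /admits_pair_flow[T [f fP]].
by rewrite leNgt; apply/negP => /(pair_flow_lt4 G_cubic fP).
Qed.

Lemma flow_number_eq4 sigma : ~ antibalanced (negative_edges sigma) ->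
  admits_nz_int_flow R sigma 4 -> flow_number R sigma = 4%:E.
Proof.
move=> nanti f4; rewrite /flow_number; case: pselect => [exk|[]]; last by exists 4%N; apply/asboolP.
case: ex_minnP => k /asboolP[k2 [tau [f [ori fl nz _]]]] kmin.
have k4 : (k <= 4)%N by apply: kmin; apply/asboolP.
suff -> : k = 4%N by [].
apply/eqP; rewrite eqn_leq k4 leqNgt; apply/negP => lt4.
have [T [g gP]] : exists T g, pair_flow sigma (k%:R : R) T g.
  by apply: admits_pair_flow; split=> //; exists tau, f; split.
by case: nanti; apply: pair_flow_lt4 gP _ => //; rewrite ltr_nat.
Qed.

Lemma int_flow_flow sigma k : admits_nz_int_flow R sigma k ->
  admits_nz_flow sigma (k%:R : R).
Proof. by case=> k2 [tau [f [ori fl nz _]]]; split=> //; exists tau, f. Qed.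

Lemma transversal_int_flow4 X : odd_transversal (~: M) X ->
  admits_nz_int_flow R (signature_of X) 4.
Proof.
move=> XT; have [T [f [fP fint]]] := transversal_flow4 R G_cubic M1 XT.
have [ori fl nz] := pair_flow_half_edges fP.
by split; [lra | exists (on_half_edges T), f].
Qed.

End FlowNumbers.

Theorem theorem6p3 (R : realType) (G : multigraph)
    (G_cubic : cubic G)
    (G_nonbipartite : ~ bipartite G)
    (G_1factor : exists M : {set edge G}, factor 1 M) :
  (exists sigma : signature G,
      [/\ #|negative_edges sigma| = oddness G,
          circular_flow_number R sigma = flow_number R sigma &
          flow_number R sigma = 4%:E]) /\
  (bridgeless G ->
    forall X3 : {set edge G}, minimal_set (3 : R) X3 ->
    exists X4 : {set edge G},
      [/\ minimal_set (4 : R) X4, X4 \proper X3 &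
          (#|X4| <= oddness G < #|X3|)%N]).
Proof.
have anti0 : ~ antibalanced (set0 : {set edge G}).
  move=> [A AE]; apply: G_nonbipartite; exists A => e.
  have := congr1 (fun D : {set edge G} => e \in D) AE.
  by rewrite inE in_setC inE => /esym/negbFE/eqP.
have [e0 _] : exists e0 : edge G, True.
  apply/notP => noe; case: G_nonbipartite; exists set0 => e.
  by case: noe; exists e.
have [M0 M01] := G_1factor.
have [F F2 cardF] := oddness_attained e0 (factor_compl G_cubic M01).
pose M := ~: F; have M1 : factor 1 M := factor2_compl G_cubic F2.
have FE : F = ~: M by rewrite setCK.
split.
  have [X [XT nanti]] : exists X, odd_transversal F X /\ ~ antibalanced X.
    apply/notP => none; have all X : odd_transversal F X -> antibalanced X.
      by move=> XT; apply/notP => nX; apply: none; exists X.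
    have O0 : odd_circuits F = set0.
      by rewrite FE in all *; apply: (no_odd_circuit e0 G_cubic M1 all).
    have [X [XT _ cX]] := transversal_in e0 F2 (@odd_circuit_meetsT G F).
    move: cX; rewrite O0 cards0 => /cards0_eq X0.
    by apply: anti0; rewrite -X0; apply: all.
  have cardX : #|X| = oddness G by rewrite -cardF; apply: transversal_card e0 _ _ F2 XT.
  rewrite FE in XT; have f4 := transversal_int_flow4 R G_cubic M1 XT.
  have nantiX : ~ antibalanced (negative_edges (signature_of X)) by rewrite negative_edgesK.
  have flow4 := flow_number_eq4 G_cubic nantiX f4.
  exists (signature_of X); split; rewrite ?negative_edgesK // flow4.
  exact: circular_flow_number_eq4 nantiX (int_flow_flow f4).
move=> /bridgeless_cut cut1 X3 [X3_3 X3min].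
have anti3 : antibalanced X3.
  by move/(circular_flow_number_eq3 R e0 G_cubic M1): X3_3; rewrite negative_edgesK.
have ltX3 : (oddness G < #|X3|)%N.
  have [X30|[e eX3]] := set_0Vmem X3; first by case: anti0; rewrite -X30.
  have [M' M'1 eM'] := edge_in_factor G_cubic e cut1.
  have F'2 := factor_compl G_cubic M'1.
  apply: leq_ltn_trans (oddness_le F'2) _.
  apply: (@leq_ltn_trans #|X3 :\: M'|); last first.
    apply: proper_card; apply/properP; split; first exact: subsetDl.
    by exists e; rewrite // inE eM'.
  apply: (odd_circuits_le e0 F'2) => C CO; have := antibalanced_meets anti3 CO.
  have [/subsetP CM' _ _] := odd_circuitsP CO.
  case/set0Pn=> x /setIP[xC xX3]; apply/set0Pn; exists x; rewrite !inE xC xX3 andbT /=.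
  by have := CM' x xC; rewrite inE.
have [X [XT XX3 cX]] := transversal_in e0 F2 (@antibalanced_meets G F X3 ^~ anti3).
rewrite cardF in cX; rewrite FE in XT.
have XpX3 : X \proper X3 by rewrite properEcard XX3 cX.
have nantiX (Z : {set edge G}) : Z \proper X3 -> ~ antibalanced Z.
  move=> ZX3 anti; apply: (X3min (signature_of Z)); first by rewrite negative_edgesK.
  by apply/(circular_flow_number_eq3 R e0 G_cubic M1); rewrite negative_edgesK.
pose P (Z : {set edge G}) := `[< circular_flow_number R (signature_of Z) = 4%:E >].
have PX : P X.
  apply/asboolP; apply: circular_flow_number_eq4 => //.
    by rewrite negative_edgesK; apply: nantiX.
  exact/int_flow_flow/(transversal_int_flow4 R G_cubic M1 XT).
have [X4 /minsetP[/asboolP PX4 X4min] X4X] := minset_exists PX.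
exists X4; split.
- split=> // sigma' sX4 E; have := X4min (negative_edges sigma').
  rewrite /P signature_ofK => H; move: (sX4); rewrite H ?properxx //.
    exact/asboolP.
  exact: proper_sub sX4.
- exact: sub_proper_trans X4X XpX3.
by rewrite ltX3 andbT -cX subset_leq_card.
Qed.
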